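(* Let $p,q$ be primes with $q\mid p-1$, let $\ell>1$ be a divisor of $p-1$, and let $i$ be an integer with either $(q,i)=(2,1)$, or $q$ odd and $1\le i\le(q-1)/2$. Suppose $\Gamma=\Gamma(pq,\ell,i)$ is vertex-primitive (that is, $\mathrm{Aut}\,\Gamma$ acts primitively on the vertices). Then $(p,q,\ell,i)=(7,3,2,1)$ and $\Gamma$ is isomorphic to the flag graph $\Gamma_F$ of the Fano plane, with automorphism group $\mathrm{PGL}(3,2).\mathbb{Z}_2$.
   Context: For a group $G$ and an inverse-closed subset $S\subseteq G\setminus\{1\}$, $\mathrm{Cay}(G,S)$ is the graph with vertex set $G$ and edges $\{x,y\}$ with $yx^{-1}\in S$. For $H\leqslant\mathrm{Aut}(G)$ and $g\in G\setminus\{1\}$, $\Gamma(G,H,g):=\mathrm{Cay}(G,g^H\cup g^{-H})$, where $g^H$ is the $H$-orbit of $g$ and $g^{-H}=(g^{-1})^H$. Let $A=\mathrm{AGL}(1,p)$ be the group of maps $x\mapsto xa+b$ of $\mathbb{Z}_p$ ($a\ne0$), with maps composed left to right. Let $m$ be a fixed primitive element of $\mathbb{Z}_p$, write $m$ also for the map $x\mapsto xm$, and let $t:x\mapsto x+1$, so $m^{-1}tm=t^m$. Put $z=m^{(p-1)/q}$, $G_{pq}=\langle z,t\rangle\leqslant A$. Subgroups of $A$ act on $G_{pq}$ by conjugation. For a divisor $\ell>1$ of $p-1$, $H_{(\ell,1)}=\langle m^{(p-1)/\ell}t\rangle$ and $\Gamma(pq,\ell,i):=\Gamma(G_{pq},H_{(\ell,1)},z^i)$.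 The flag graph $\Gamma_F$ of the Fano plane has as vertices the $21$ incident point-line pairs $(P,L)$, with distinct flags $(P,L),(P',L')$ adjacent iff $P=P'$ or $L=L'$. $N.\mathbb{Z}_2$ denotes a group with a normal subgroup isomorphic to $N$ of index $2$ (here the group is isomorphic to $\mathrm{PGL}(2,7)$). *)

(* Defs.v *)
From mathcomp Require Import all_boot all_order all_fingroup all_algebra all_solvable.

Set Implicit Arguments.
Unset Strict Implicit.
Unset Printing Implicit Defensive.

Import GRing.Theory GroupScope.

(* A finite graph is given by its vertex type and its adjacency relation. *)

Definition graph_iso (V W : finType) (e : rel V) (f : rel W) : Prop :=
  exists2 h : V -> W, bijective h & forall x y, f (h x) (h y) = e x y.

Section GraphAutomorphisms.

Variables (V : finType) (e : rel V).

Definition graph_aut : {set {perm V}} :=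
  [set s : {perm V} | [forall x : V, forall y : V, e (s x) (s y) == e x y]].

Lemma graph_autP (s : {perm V}) :
  reflect (forall x y, e (s x) (s y) = e x y) (s \in graph_aut).
Proof.
rewrite inE; apply: (iffP forallP) => h x; first by move=> y; apply/eqP/(forallP (h x)).
by apply/forallP=> y; rewrite h.
Qed.

Lemma graph_aut_group_set : group_set graph_aut.
Proof.
apply/group_setP; split=> [|s t /graph_autP es /graph_autP et].
  by apply/graph_autP=> x y; rewrite !perm1.
by apply/graph_autP=> x y; rewrite !permM et es.
Qed.

Canonical graph_aut_group := Group graph_aut_group_set.

Definition vertex_primitive : bool := [primitive graph_aut, on setT | 'P].

End GraphAutomorphisms.

Section CayleyGraphs.

Variables (gT : finGroupType) (G : {group gT}).

Definition Cay (S : {set gT}) : rel (subg_of G) :=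
  [rel x y | sgval y * (sgval x)^-1 \in S].

(* H is meant to be a set of automorphisms of G (H \subset Aut G), acting on
   elements of G by evaluation. *)
Definition orbit_Cay (H : {set {perm gT}}) (g : gT) : rel (subg_of G) :=
  Cay (orbit 'P H g :|: orbit 'P H g^-1).

End CayleyGraphs.

Arguments Cay {gT} G%_G S%_g.
Arguments orbit_Cay {gT} G%_G H%_g g%_g.

Section Frobenius.

Variable p : nat.

Lemma affine_inj (a : {unit 'F_p}) (b : 'F_p) :
  injective (fun x : 'F_p => (x * val a + b)%R).
Proof. by move=> x y /addIr /(mulIr (valP a)). Qed.

(* Permutations compose from left to right in the group {perm 'F_p}. *)
Definition affine (a : {unit 'F_p}) (b : 'F_p) : {perm 'F_p} :=
  perm (@affine_inj a b).

Definition AGL1 : {set {perm 'F_p}} :=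
  [set affine u.1 u.2 | u : {unit 'F_p} * 'F_p].

Definition scaling (m : {unit 'F_p}) : {perm 'F_p} := affine m 0%R.

Definition translation : {perm 'F_p} := affine 1 1%R.

Variables (m : {unit 'F_p}) (q : nat).

Definition zgen : {perm 'F_p} := scaling m ^+ (p.-1 %/ q).

Definition Gpq : {set {perm 'F_p}} := <<[set zgen; translation]>>.
Canonical Gpq_group := [group of Gpq].

Definition H1 (l : nat) : {set {perm 'F_p}} :=
  <[scaling m ^+ (p.-1 %/ l) * translation]>.
Canonical H1_group l := [group of H1 l].

(* conj_aut G maps 'N(G) to Aut G; H1 l normalises Gpq (H1_norm below). *)
Definition Gamma_pq (l i : nat) : rel (subg_of Gpq_group) :=
  orbit_Cay Gpq_group (conj_aut Gpq_group @* H1 l) (zgen ^+ i).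

Lemma affineM a b c d : affine a b * affine c d = affine (a * c) (b * val c + d)%R.
Proof.
by apply/permP=> x; rewrite permM !permE /= mulrDl -addrA mulrA.
Qed.

Lemma affine1 : affine 1 0%R = 1.
Proof. by apply/permP=> x; rewrite perm1 permE /= mulr1 addr0. Qed.

Lemma AGL1_group_set : group_set AGL1.
Proof.
apply/group_setP; split.
  by rewrite -affine1; apply/imsetP; exists (1, 0%R).
move=> _ _ /imsetP[[a b] _ ->] /imsetP[[c d] _ ->]; rewrite affineM.
by apply/imsetP; exists (a * c, (b * val c + d)%R).
Qed.
Canonical AGL1_group := Group AGL1_group_set.

Lemma mem_AGL1 a b : affine a b \in AGL1.
Proof. by apply/imsetP; exists (a, b). Qed.

Lemma translation_exp n : translation ^+ n = affine 1 (n%:R)%R.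
Proof.
elim: n => [|n IHn]; first by rewrite expg0 affine1.
by rewrite expgSr IHn affineM mul1g mulr1 mulrSr.
Qed.

Lemma affine_1_Gpq b : affine 1 b \in Gpq.
Proof.
rewrite -(natr_Zp b) -translation_exp groupX // mem_gen //.
by rewrite !inE eqxx orbT.
Qed.

Lemma scaling_exp n : scaling m ^+ n = affine (m ^+ n) 0%R.
Proof.
elim: n => [|n IHn]; first by rewrite !expg0 affine1.
by rewrite !expgSr IHn affineM mul0r addr0.
Qed.

Lemma affineJ a b c d : exists d', affine c d ^ affine a b = affine c d'.
Proof.
have aV : (val (a^-1)%g * val a = 1 :> 'F_p)%R by rewrite -[LHS]/(val ((a^-1)%g * a)%g) mulVg.
have -> : affine c d ^ affine a b
          = affine a^-1 (- (b * val (a^-1)%g))%R * affine c d * affine a b.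
  rewrite conjgE mulgA; congr (_ * _ * _); apply: (mulIg (affine a b)).
  by rewrite mulVg affineM mulVg mulNr -mulrA aV mulr1 addNr affine1.
rewrite !affineM; have -> : a^-1 * c * a = c; last by eexists.
by apply: val_inj; rewrite /= mulrAC aV mul1r.
Qed.

Lemma AGL1_norm_Gpq : AGL1 \subset 'N(Gpq).
Proof.
apply/subsetP=> _ /imsetP[[a b] _ ->] /=.
have memJ c d : affine c d \in Gpq -> affine c d ^ affine a b \in Gpq.
  have [d' ->] := affineJ a b c d => Gcd.
  have -> : affine c d' = affine c d * affine 1 (d' - d)%R.
    by rewrite affineM mulg1 mulr1 addrC subrK.
  by rewrite groupM ?affine_1_Gpq.
rewrite inE -genJ gen_subG conjUg !conjg_set1 subUset !sub1set.
apply/andP; split; last exact/memJ/affine_1_Gpq.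
rewrite /zgen scaling_exp; apply: memJ.
by rewrite -scaling_exp mem_gen // !inE eqxx.
Qed.

Lemma H1_norm l : H1 l \subset 'N(Gpq).
Proof.
apply: subset_trans AGL1_norm_Gpq.
by rewrite cycle_subG groupM ?mem_AGL1 // scaling_exp mem_AGL1.
Qed.

End Frobenius.

Arguments Gamma_pq {p} m q l i.

(* The Fano plane PG(2,2).  Over F_2 the points (1-dimensional subspaces of
   F_2^3) are the nonzero vectors, and the three points on a line
   (2-dimensional subspace) are the nonzero vectors a, b, a + b. *)

Definition fano_point (v : 'rV['F_2]_3) : bool := (v != 0)%R.

Definition fano_line (L : {set 'rV['F_2]_3}) : bool :=
  [exists a, exists b,
    [&& fano_point a, fano_point b, a != b & L == [set a; b; (a + b)%R]]].

Definition fano_flag : finType :=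
  {f : 'rV['F_2]_3 * {set 'rV['F_2]_3}
     | [&& fano_point f.1, fano_line f.2 & f.1 \in f.2]}.

Definition fano_flag_graph : rel fano_flag :=
  [rel f g | (f != g) && (((val f).1 == (val g).1) || ((val f).2 == (val g).2))].

Definition PGL (n : nat) (F : finFieldType) := 'GL_n[F] / 'Z('GL_n[F]).

(* Main.v *)
Require Import Defs.
From mathcomp Require Import all_boot all_order all_fingroup all_algebra all_solvable all_field.
From mathcomp Require Import ring zify.

(* Put w = z ^ i and let U be the subgroup of order l of the units of F_p.  The
   graph is isomorphic to the one on Z_q x F_p in which (j, b) is joined to
   (j + 1, b + w ^ j u) for u in U; call the fibres of the first projection layers.

   If q = 2, vertices with a common neighbour lie in the same layer, so the layers
   give imprimitivity.  If q is odd, the functions constant on layers yield the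
   eigenvalues theta_k = l (om ^ k + om ^ - k), with om a primitive q-th root of 1.
   If they were the only eigenfunctions for theta_1, then taking the same value
   under all of them would be a nontrivial invariant equivalence.  By Fourier
   transform on F_p, primitivity thus makes theta_1 an eigenvalue of some M_r with
   r <> 0, where M_r is a Hermitian weighted q-cycle whose weights are Gauss
   periods.  Galois conjugation makes every theta_k with k <> 0 an eigenvalue of
   every M_r with r <> 0, and the value of the sum of the traces of the M_r ^ 2
   then forces l = 2 or (q, l) = (3, 3).  If l = 2 and q > 3, then 4 divides
   det M_r, which is twice a unit; if (q, l) = (3, 3), then M_r is a circulant
   matrix and the average of the Gauss periods is wrong.

   If (q, l) = (3, 2), the graph is the line graph of a hexagonal tessellation of a
   torus.  Its hexagons are the faces unless p = 7, because p would divide a small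
   norm from the Eisenstein integers; opposite vertices of a face lie in the same
   layer, which again gives imprimitivity.  If p = 7 the graph is the flag graph of
   the Fano plane.  An automorphism is determined by the image of a frame of four
   flags, of which there are 336.  The group PGL(2, 7) acts by conjugation on the
   21 traceless matrices of determinant 1 modulo sign, adjacency being
   orthogonality for the trace form, and GL(3, 2) acts on the flags. *)

Set Implicit Arguments.
Unset Strict Implicit.
Unset Printing Implicit Defensive.

Import Order.TTheory GRing.Theory Num.Theory GroupScope.

(** * Invariant equivalences, primitivity and graph isomorphisms *)

Section InvariantRelations.

Variables (V : finType) (e : rel V).

Lemma graph_aut_conn s x y : s \in graph_aut e -> e (s x) (s y) = e x y.
Proof. by move/graph_autP. Qed.

(** The classes form a partition [Q] permuted by the automorphisms. Primitivity excludes block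
    systems strictly between the two trivial ones. *)
Lemma primitive_equivalence (R : rel V) :
    vertex_primitive e -> equivalence_rel R ->
    (forall s x y, s \in graph_aut e -> R x y -> R (s x) (s y)) ->
  (forall x y, R x y) \/ (forall x y, R x y -> x = y).
Proof.
move=> /andP[_ primE] eqR invR; have Rxx x : R x x := (eqR x x x).1.
have{} eqR' : {in [set: V] & &, equivalence_rel R} by move=> x y z _ _ _; apply: eqR.
pose Q := equivalence_partition R [set: V].
have partQ : partition Q [set: V] by apply: equivalence_partitionP.
have invR' s x y : s \in graph_aut e -> R (s x) (s y) = R x y.
  move=> sA; apply/idP/idP; last exact: invR.
  have sVA : s^-1 \in graph_aut e by rewrite (groupV (graph_aut_group e)).
  by move/(invR _ _ _ sVA); rewrite !permK.
have QE B : reflect (exists x, B = [set y | R x y]) (B \in Q).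
  apply: (iffP imsetP) => [[x _ ->]|[x ->]]; exists x; rewrite ?inE //.
    by apply/setP=> y; rewrite !inE.
  by apply/setP=> y; rewrite !inE.
have actsQ : [acts graph_aut e, on Q | 'P^*].
  apply/subsetP => s sA; rewrite !inE /=; apply/subsetP => B /QE[x ->].
  rewrite !inE; apply/QE; exists (s x); apply/setP => y; rewrite !inE.
  apply/imsetP/idP => [[y' + ->]|Rsy].
    by rewrite inE -(invR' s).
  by exists (s^-1 y); rewrite /= ?inE ?apermE ?permKV // -(invR' s) // permKV.
have : ~~ (1 < #|Q| < #|[set: V]|).
  by apply: contra primE => h; apply/existsP; exists Q; rewrite /imprimitivity_system partQ actsQ.
rewrite negb_and -!leqNgt => /orP[leQ1|leVQ].
  left=> x y; have Qx : [set z | R x z] \in Q by apply/QE; exists x.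
  have Qy : [set z | R y z] \in Q by apply/QE; exists y.
  have /setP/(_ y) := card_le1_eqP leQ1 _ _ Qx Qy.
  by rewrite !inE Rxx => <-.
right=> x y Rxy; have injQ : {in [set: V] &, injective (fun x => [set y in [set: V] | R x y])}.
  by apply/imset_injP; rewrite eqn_leq leq_imset_card.
by apply: injQ; rewrite ?inE //; apply/setP=> z; rewrite !inE; exact: (eqR x y z).2.
Qed.

(** The components of [R] are the classes of an invariant equivalence. Two distinct related points
    prevent it from being equality, so there is only one component, and [f] is constant on it. *)
Lemma primitive_relation (T : eqType) (f : V -> T) (R : rel V) :
    vertex_primitive e -> symmetric R ->
    (forall s x y, s \in graph_aut e -> R x y -> R (s x) (s y)) ->
    (forall x y, R x y -> f x = f y) ->
    (exists x, exists2 y, R x y & x != y) ->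
  forall x y, f x = f y.
Proof.
move=> primE symR invR fR [x0 [y0 Rxy0 neq0]].
have csym := sym_connect_sym symR.
have eqC : equivalence_rel (connect R).
  apply/equivalence_relP; split; first exact: connect0.
  by move=> x y Rxy z; apply: same_connect.
have invC s x y : s \in graph_aut e -> connect R x y -> connect R (s x) (s y).
  move=> sA /connectP[p + ->]; elim: p x => [|z p IHp] x /=; first by rewrite connect0.
  case/andP=> Rxz /IHp; apply: connect_trans; apply: connect1; exact: invR.
have fC x y : connect R x y -> f x = f y.
  move=> /connectP[p + ->]; elim: p x => //= z p IHp x /andP[/fR->]; exact: IHp.
case: (primitive_equivalence primE eqC invC) => [h x y|h]; first exact: fC.
by rewrite (h x0 y0) ?eqxx // ?connect1 in neq0.
Qed.

End InvariantRelations.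

Section GraphIso.

Variables (V W : finType) (e : rel V) (f : rel W).

Lemma graph_iso_sym : graph_iso e f -> graph_iso f e.
Proof.
case=> h [g hK gK] he; exists g; first by exists h.
by move=> x y; rewrite -he !gK.
Qed.

Lemma graph_iso_trans (X : finType) (g : rel X) :
  graph_iso e f -> graph_iso f g -> graph_iso e g.
Proof.
case=> h hB he [k kB ke]; exists (k \o h); first exact: bij_comp.
by move=> x y; rewrite /= ke he.
Qed.

Lemma graph_iso_aut : graph_iso e f -> graph_aut e \isog graph_aut f.
Proof.
case=> h [g hK gK] he.
have cinj (s : {perm V}) : injective (fun x => h (s (g x))).
  by move=> x y /(can_inj hK)/perm_inj/(can_inj gK).
pose c s := perm (cinj s).
have cM : {in graph_aut e &, {morph c : x y / x * y}}.
  by move=> s t _ _; apply/permP=> x; rewrite permM !permE /= hK.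
apply/isogP; exists (Morphism cM).
  apply/injmP=> s t _ _ /permP st; apply/permP=> x.
  by have := st (h x); rewrite /= !permE hK => /(can_inj hK).
rewrite morphimEdom; apply/setP=> s; apply/imsetP/idP => [[t tA ->]|sA].
  apply/graph_autP=> x y; rewrite !permE he (graph_autP _ _ tA).
  by rewrite -he !gK.
have dinj : injective (fun x => g (s (h x))).
  by move=> x y /(can_inj gK)/perm_inj/(can_inj hK).
exists (perm dinj); last by apply/permP=> x; rewrite !permE /= ?permE !gK.
apply/graph_autP=> x y; rewrite !permE -he !gK (graph_autP _ _ sA).
exact: he.
Qed.

End GraphIso.

(** An imprimitivity system for [f] pulls back to one for [e] by preimages under [h]; [conjA]
    carries automorphisms of [e] over to [f]. *)
Lemma graph_iso_primitive (V W : finType) (e : rel V) (f : rel W) :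
  graph_iso e f -> vertex_primitive e -> vertex_primitive f.
Proof.
move=> iso prim; have [h hB he] := iso; have [g hK gK] := hB.
have conjA s : s \in graph_aut e -> exists2 t, t \in graph_aut f & forall x, t (h x) = h (s x).
  move=> sA; have cinj : injective (fun x => h (s (g x))).
    by move=> x y /(can_inj hK)/perm_inj/(can_inj gK).
  exists (perm cinj) => [|x]; last by rewrite permE hK.
  by apply/graph_autP=> x y; rewrite !permE he (graph_autP _ _ sA) -he !gK.
have [/imsetP[x0 _ trE] /existsPn primE] := andP prim.
apply/andP; split.
  apply/imsetP; exists (h x0); rewrite ?inE //; apply/setP=> y; rewrite inE; symmetry.
  have : g y \in [set: V] by rewrite inE.
  rewrite trE => /imsetP[s sA gy].
  have [t tA th] := conjA _ sA; apply/imsetP; exists t => //=.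
  by rewrite apermE th -[RHS]/(h (aperm x0 s)) -gy gK.
apply/existsPn=> Q; apply: contra (primE [set h @^-1: (B : {set W}) | B in Q]).
move=> /and3P[/and3P[/eqP covQ trivQ nt0] actsQ /andP[Qgt1 QltW]].
have preK (B : {set W}) : h @: (h @^-1: B) = B.
  apply/setP=> y; apply/imsetP/idP => [[x + ->]|By]; first by rewrite inE.
  by exists (g y); rewrite ?inE gK.
have preI : injective (fun B : {set W} => h @^-1: B).
  by move=> B C /(congr1 (fun D : {set V} => h @: D)); rewrite !preK.
have cardVW : #|V| = #|W| by apply: bij_eq_card hB.
rewrite /imprimitivity_system card_imset // cardsT cardVW -cardsT Qgt1 QltW !andbT.
apply/andP; split; last first.
  apply/subsetP => s sA; rewrite !inE /=; apply/subsetP => _ /imsetP[B BQ ->].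
  have [t tA th] := conjA _ sA.
  rewrite !inE; apply/imsetP; exists (('P^*)%act B t).
    by rewrite (actsP actsQ).
  apply/setP=> x; rewrite !inE; apply/imsetP/imsetP => [[y]|[y By]] /=.
    by rewrite inE => hy ->; exists (h y) => //; rewrite /= !apermE th.
  rewrite apermE -[y]gK th => /(can_inj hK) ->; exists (g y); last by rewrite /= apermE.
  by rewrite inE gK.
apply/and3P; split.
- apply/eqP/setP=> x; rewrite inE; have : h x \in cover Q by rewrite covQ inE.
  case/bigcupP=> B BQ Bx; apply/bigcupP; exists (h @^-1: B); rewrite ?inE //.
  exact: imset_f.
- apply/trivIsetP=> _ _ /imsetP[B BQ ->] /imsetP[C CQ ->] neqBC.
  rewrite -setI_eq0 -preimsetI; apply/eqP/setP=> x; rewrite !inE.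
  have /(trivIsetP trivQ _ _ BQ CQ) : B != C by apply: contraNneq neqBC => ->.
  by rewrite -setI_eq0 => /eqP/setP/(_ (h x)); rewrite !inE.
- apply: contra nt0 => /imsetP[B BQ B0]; rewrite -(_ : B = set0) //.
  by rewrite -(preK B) -B0 imset0.
Qed.

(** * The graph as a union of layers *)

Section LayeredGraph.

Variables p q : nat.

Definition layer_step (w : 'F_p) (U : {set 'F_p}) : rel ('Z_q * 'F_p) :=
  [rel x y : 'Z_q * 'F_p | (y.1 == x.1 + 1)%R && ((y.2 - x.2) / w ^+ x.1 \in U)%R].

Definition layered_graph (w : 'F_p) (U : {set 'F_p}) : rel ('Z_q * 'F_p) :=
  [rel x y : 'Z_q * 'F_p | layer_step w U x y || layer_step w U y x].

End LayeredGraph.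

Arguments layer_step {p} q w U.
Arguments layered_graph {p} q w U.

(** Exponents are representatives below [q]; the reduction of their sum modulo [q] is absorbed by
    [x ^+ q = 1]. *)
Lemma expg_ZpD (gT : finGroupType) (x : gT) q (j k : 'Z_q) :
  1 < q -> x ^+ q = 1 -> x ^+ (j + k)%R = x ^+ j * x ^+ k.
Proof.
move=> q_gt1 xq; rewrite -expgD -[RHS](expg_mod _ xq) /=; congr (x ^+ (_ %% _)).
exact: Zp_cast.
Qed.

Lemma affine_injective p (a b : {unit 'F_p}) (c d : 'F_p) :
  affine a c = affine b d -> a = b /\ c = d.
Proof.
move/permP=> eqab; have := eqab 0%R; rewrite !permE /= !mul0r !add0r => eqcd.
split=> //; apply: val_inj; have := eqab 1%R; rewrite !permE /= !mul1r eqcd.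
exact: addIr.
Qed.

Section CayleyIsLayered.

Variables (p q l i : nat) (m : {unit 'F_p}).
Hypotheses (p_prime : prime p) (q_prime : prime q) (q_dvd : q %| p.-1).
Hypotheses (m_primitive : <[m]> = [set: {unit 'F_p}]).
Hypotheses (l_gt1 : 1 < l) (l_dvd : l %| p.-1) (i_gt0 : 0 < i) (i_ltq : i < q).

Let W := (m ^+ (p.-1 %/ q) ^+ i).
Let a := (m ^+ (p.-1 %/ l)).

Lemma order_primitive : #[m] = p.-1.
Proof. by rewrite /order m_primitive card_finField_unit card_Fp. Qed.

Lemma order_primitive_exp d : d %| p.-1 -> #[m ^+ (p.-1 %/ d)] = d.
Proof.
have p1 : 0 < p.-1 by rewrite -subn1 subn_gt0 prime_gt1.
move=> d_dvd; have d_gt0 : 0 < d by apply: dvdn_gt0 d_dvd.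
rewrite orderXdiv order_primitive ?dvdn_div //; last first.
by rewrite divnA // mulKn.
Qed.

Lemma order_W : #[W] = q.
Proof.
rewrite orderXgcd order_primitive_exp //.
have /eqP -> : coprime q i; last by rewrite divn1.
by rewrite prime_coprime // gtnNdvd.
Qed.

(* The fixed point of the generator of H1 l. *)
Let c0 : 'F_p := (1 - val a)^-1%R.
Let kappa : 'F_p := ((1 - val W) * c0)%R.

Let val_expg (u : {unit 'F_p}) n : val (u ^+ n) = (val u ^+ n)%R.
Proof. by elim: n => // n IHn; rewrite expgS exprS /= -IHn. Qed.

Let c0K : (c0 * (1 - val a) = 1)%R.
Proof.
rewrite mulVf // subr_eq0; apply: contraTneq l_gt1 => a1.
have /eqP : a = 1 by apply: val_inj.
by rewrite -order_eq1 order_primitive_exp // => /eqP ->.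
Qed.

Let kappa_neq0 : kappa != 0%R.
Proof.
rewrite mulf_neq0 //; last first.
  by apply: contraTneq isT => c00; move: c0K; rewrite c00 mul0r => /esym/eqP; rewrite oner_eq0.
rewrite subr_eq0; apply: contraTneq (prime_gt1 q_prime) => W1.
have /eqP : W = 1 by apply: val_inj.
by rewrite -order_eq1 order_W // => /eqP ->.
Qed.

(* The constants make multiplication by a conjugate of z ^ i on the left a step
   from one layer to the next. *)
Let phi (x : 'Z_q * 'F_p) : {perm 'F_p} :=
  affine (W ^+ x.1) (c0 * (1 - val (W ^+ x.1)%g) - kappa * x.2)%R.

Let G := Gpq_group m q.

Let zgenE : zgen m q = affine (m ^+ (p.-1 %/ q)) 0%R.
Proof. exact: scaling_exp. Qed.

Let zgen_expE n : zgen m q ^+ n = affine (m ^+ (p.-1 %/ q) ^+ n) 0%R.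
Proof. by rewrite /zgen -expgM scaling_exp expgM. Qed.

Let phi_G x : phi x \in G.
Proof.
have -> : phi x = zgen m q ^+ (i * x.1) * affine 1 (c0 * (1 - val (W ^+ x.1)%g) - kappa * x.2)%R.
  by rewrite zgen_expE affineM mul0r add0r mulg1 expgM.
by rewrite groupM ?affine_1_Gpq // groupX // mem_gen // !inE eqxx.
Qed.

(** The affine maps with multiplier in the subgroup of order [q] form a group containing both
    generators. The bound makes the injection [phi] a bijection onto [G]. *)
Let card_G : #|G| <= q * p.
Proof.
pose X := [set affine u.1 u.2 | u in setX <[m ^+ (p.-1 %/ q)]> [set: 'F_p]].
have Xgroup : group_set X.
  apply/group_setP; split.
    by rewrite -affine1; apply/imsetP; exists (1, 0%R); rewrite ?inE //= group1.
  move=> _ _ /imsetP[[b c] + ->] /imsetP[[d f] + ->]; rewrite !inE !andbT /= => hb hd.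
  by rewrite affineM; apply/imsetP; exists (b * d, (c * val d + f)%R); rewrite ?inE ?andbT //= groupM.
have GX : G \subset Group Xgroup.
  rewrite gen_subG subUset !sub1set zgenE; apply/andP; split; apply/imsetP.
    by exists (m ^+ (p.-1 %/ q), 0%R); rewrite ?inE //= cycle_id.
  by exists (1, 1%R); rewrite ?inE //= group1.
apply: leq_trans (subset_leq_card GX) _; apply: leq_trans (leq_imset_card _ _) _.
rewrite cardsX cardsT card_Fp // leq_mul2r.
by rewrite -[#|_|]/(#[_]) order_primitive_exp // leqnn orbT.
Qed.

Let expgW_inj (j k : 'Z_q) : W ^+ j = W ^+ k -> j = k.
Proof.
move/eqP; rewrite eq_expg_mod_order order_W => /eqP eqjk; apply: val_inj.
have ltq (n : 'Z_q) : n < q by rewrite -{2}(Zp_cast (prime_gt1 q_prime)).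
by rewrite -[LHS](modn_small (ltq j)) eqjk modn_small.
Qed.

Let phi_inj : injective phi.
Proof.
move=> [j b] [k c] /affine_injective[/= /expgW_inj ->].
by move=> /addrI/oppr_inj/(mulfI kappa_neq0) ->.
Qed.

(** The powers of the generator of [H1 m l] fix [c0] and have multiplier [a ^+ n], so they conjugate
    [z ^ i] into [affine W (kappa * (1 - a ^+ n))]. Under [phi], left multiplication by this map
    takes [(j, b)] to [(j + 1, b + W ^ j a ^ n)]. *)
Let phi_step x y : layer_step q (val W) [set val u | u in <[a]>] x y =
  [exists h in H1 m l, phi y * (phi x)^-1 == zgen m q ^+ i ^ h].
Proof.
have kE n : (scaling m ^+ (p.-1 %/ l) * translation p) ^+ n
            = affine (a ^+ n) (c0 * (1 - val a ^+ n))%R.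
  elim: n => [|n IHn]; first by rewrite !expg0 subrr mulr0 affine1.
  rewrite expgSr IHn scaling_exp affineM mulg1 mul0r add0r affineM -expgSr.
  congr affine; rewrite exprSr; move: c0K; set v := val a => c0v.
  by rewrite -[X in (_ + X)%R]c0v; ring.
have conjE n : zgen m q ^+ i ^ (affine (a ^+ n) (c0 * (1 - val a ^+ n))%R)
   = affine W (kappa * (1 - val a ^+ n))%R.
  rewrite zgen_expE; apply: (mulgI (affine (a ^+ n) (c0 * (1 - val a ^+ n))%R)).
  rewrite -conjgC !affineM mul0r add0r; congr affine.
    by apply: val_inj; rewrite /= mulrC.
  by rewrite /kappa; ring.
have WS n : val (W ^+ n) != 0%R by apply/negP=> /eqP W0; have := valP (W ^+ n); rewrite W0 unitr0.
have stepE n : (phi y * (phi x)^-1 == affine W (kappa * (1 - val a ^+ n))%R)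
     = (y.1 == x.1 + 1)%R && (y.2 - x.2 == val (W ^+ x.1)%g * val a ^+ n)%R.
  rewrite (can2_eq (mulgKV _) (mulgK _)) affineM.
  have Wx1 : W * W ^+ x.1 = W ^+ (x.1 + 1)%R.
    by rewrite expg_ZpD ?prime_gt1 // -?order_W ?expg_order // expg1 -expgSr expgS.
  apply/idP/idP => [/eqP/affine_injective[]|/andP[/eqP eq1 /eqP eq2]].
    rewrite Wx1 => /expgW_inj -> eq2; rewrite eqxx andTb; apply/eqP.
    apply: (mulfI kappa_neq0); apply/eqP; rewrite -subr_eq0 -oppr_eq0; apply/eqP.
    move/eqP: eq2; rewrite -Wx1 -subr_eq0 => /eqP <-; rewrite FinRing.val_unitM /kappa; ring.
  rewrite Wx1 -eq1; apply/eqP; congr affine; rewrite eq1 -Wx1 FinRing.val_unitM.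
  have -> : (y.2 = x.2 + val (W ^+ x.1)%g * val a ^+ n)%R by rewrite -eq2 addrC subrK.
  by rewrite /kappa; ring.
rewrite /layer_step /= -val_expg; apply/andP/exists_inP => [[y1 /imsetP[_ /cycleP[n ->] eqn]]|].
  exists ((scaling m ^+ (p.-1 %/ l) * translation p) ^+ n); first exact: mem_cycle.
  rewrite kE conjE stepE y1 -val_expg; apply/eqP.
  by rewrite -[val (a ^+ n)]eqn mulrC divfK ?WS.
case=> h hH; move: hH; rewrite /H1 => /cycleP[n ->]; rewrite kE conjE stepE.
case/andP=> y1 /eqP->; split=> //.
by apply/imsetP; exists (a ^+ n); rewrite ?mem_cycle // mulrC mulKf ?WS ?[RHS]val_expg.
Qed.

Lemma Gamma_pq_iso :
  graph_iso (Gamma_pq m q l i) (layered_graph q (val W) [set val u | u in <[a]>]).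
Proof.
have phiK x : sgval (subg G (phi x)) = phi x by rewrite subgK ?phi_G.
apply: graph_iso_sym; exists (fun x => subg G (phi x)).
  apply: inj_card_bij => [x y /(congr1 sgval)|]; first by rewrite !phiK; apply: phi_inj.
  have card_Zq : #|'Z_q| = q by rewrite card_ord Zp_cast ?prime_gt1.
  rewrite card_prod card_Zq card_Fp //.
  by apply: leq_trans card_G; rewrite card_sub.
have gG : zgen m q ^+ i \in G by rewrite groupX // mem_gen // !inE eqxx.
have orbE g y : g \in G -> (y \in orbit 'P (conj_aut G @* H1 m l) g) = [exists h in H1 m l, y == g ^ h].
  move=> Gg; have sHN := H1_norm m q l.
  apply/imsetP/exists_inP => [[s /morphimP[h hN hH ->] ->]|[h hH /eqP->]].
    by exists h; rewrite // /= apermE norm_conj_autE.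
  have hN := subsetP sHN h hH.
  by exists (conj_aut G h); rewrite ?mem_morphim //= apermE norm_conj_autE.
move=> x y; rewrite /Gamma_pq /orbit_Cay /Cay /= !phiK inE !orbE ?groupV //.
rewrite /layered_graph /= !phi_step; congr (_ || _).
(* The orbit of the inverse gives the same relation with [x] and [y] exchanged. *)
apply/exists_inP/exists_inP => [[h hH /eqP eqh]|[h hH /eqP eqh]]; exists h => //; apply/eqP.
  by rewrite -[LHS]invgK invMg invgK eqh conjVg invgK.
by rewrite conjVg -eqh invMg invgK.
Qed.

End CayleyIsLayered.

(** * Eigenfunctions of vertex-primitive graphs *)

Section PrimitiveEigenfunction.

Variables (F : fieldType) (V : finType) (e : rel V).

Definition eigenfunction (theta : F) (h : V -> F) :=
  forall x, (\sum_(y | e y x) h y = theta * h x)%R.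

Lemma eigenfunction_aut theta h s :
  s \in graph_aut e -> eigenfunction theta h -> eigenfunction theta (h \o s).
Proof.
move=> sA hE x; rewrite /= -(hE (s x)) [RHS](reindex_inj (@perm_inj _ s)) /=.
by apply: eq_bigl => y; rewrite graph_aut_conn.
Qed.

(* Being equated by all eigenfunctions for theta is an invariant equivalence, so
   that primitivity leaves some eigenfunction separating the points of a fibre. *)
Lemma primitive_eigenfunction (T : eqType) (f : V -> T) theta h :
    vertex_primitive e -> eigenfunction theta h ->
    (exists x y, h x != h y) -> (exists x y, x != y /\ f x = f y) ->
  exists2 g, eigenfunction theta g & exists x y, f x = f y /\ g x != g y.
Proof.
move=> prim hE [x1 [y1 neq1]] [x0 [y0 [neq0 fxy0]]].
pose A : 'M[F]_#|V| := (\matrix_(i, j) (e (enum_val i) (enum_val j))%:R)%R.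
pose K := eigenspace A theta.
have mulA (v : 'rV[F]_#|V|) j : ((v *m A) 0 j = \sum_(y | e y (enum_val j)) v 0 (enum_rank y))%R.
  rewrite mxE (reindex _ (onW_bij _ (enum_rank_bij V))) /= [RHS]big_mkcond /=; apply: eq_bigr => y _.
  by rewrite mxE enum_rankK; case: ifP => _; rewrite ?mulr1 ?mulr0.
have KE (v : 'rV[F]_#|V|) : (v <= K)%MS <-> eigenfunction theta (fun x => v 0%R (enum_rank x)).
  split=> [/eigenspaceP vA x|vE].
    have /rowP/(_ (enum_rank x)) := vA; rewrite mulA enum_rankK => ->.
    by rewrite mxE.
  apply/eigenspaceP/rowP=> j; rewrite mulA -[j]enum_valK enum_rankK vE mxE.
  by rewrite enum_valK.
(* The rows of [K] span the eigenspace, so points on which all rows agree are equated by every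
   eigenfunction for [theta]. *)
pose R := [rel x y | [forall i, K i (enum_rank x) == K i (enum_rank y)]].
have RP g x y : eigenfunction theta g -> R x y -> g x = g y.
  move=> gE /forallP Rxy; pose v : 'rV[F]_#|V| := (\row_i g (enum_val i))%R.
  have vx z : v 0%R (enum_rank z) = g z by rewrite mxE enum_rankK.
  have /submxP[u vK] : (v <= K)%MS.
    by apply/KE=> z; rewrite vx -gE; apply: eq_bigr => t _; rewrite vx.
  by rewrite -!vx vK !mxE; apply: eq_bigr => i _; rewrite (eqP (Rxy i)).
have rowE i : eigenfunction theta (fun x => K i (enum_rank x)).
  have rowi y : row i K 0%R y = K i y by rewrite mxE.
  move=> x; rewrite -rowi -(KE (row i K)).1 ?row_sub //.
  by apply: eq_bigr => y _; rewrite rowi.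
have eqR : equivalence_rel R.
  apply/equivalence_relP; split=> [x|x y /forallP Rxy z]; first by apply/forallP.
  by apply: eq_forallb => i; rewrite (eqP (Rxy i)).
case: (primitive_equivalence prim eqR) => [s x y sA Rxy|RT|R0].
- by apply/forallP=> i; apply/eqP; apply: (RP _ x y (eigenfunction_aut sA (rowE i))).
- by rewrite (RP _ _ _ hE (RT x1 y1)) eqxx in neq1.
have : ~~ R x0 y0 by apply: contra neq0 => /R0->.
rewrite negb_forall => /existsP[i neqi].
by exists (fun x => K i (enum_rank x)); [apply: rowE | exists x0, y0].
Qed.

End PrimitiveEigenfunction.

Lemma layer_step_shift p q (w : 'F_p) (U : {set 'F_p}) (j : 'Z_q) b u :
  w != 0%R -> u \in U -> layer_step q w U (j, b) (j + 1, b + w ^+ j * u)%R.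
Proof.
move=> w0 uU; rewrite /layer_step /= eqxx addrAC subrr add0r mulrAC divff ?mul1r //.
by rewrite expf_neq0.
Qed.

(** As 1 + 1 = 0 in ['Z_2], both kinds of step change the layer in the same way, so a common
    neighbour forces equal layers. Distinct [u] and [v] in [U] give distinct vertices with the
    common neighbour [(1, 0)]. *)
Lemma layered_graph2_imprimitive p (w : 'F_p) (U : {set 'F_p}) :
  w != 0%R -> 1 < #|U| -> ~~ vertex_primitive (layered_graph 2 w U).
Proof.
move=> w0 /card_gt1P[u [v [uU vU neq]]]; apply/negP => prim.
pose e := layered_graph 2 w U.
pose R := [rel x y | [exists z, e x z && e y z]].
have eE x y : e x y -> y.1 = (x.1 + 1)%R.
  case/orP=> /andP[/eqP-> _] //; rewrite -addrA [X in (_ + X)%R](_ : _ = 0)%R ?addr0 //.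
  exact: val_inj.
have symR : symmetric R by move=> x y; apply: eq_existsb => z; rewrite andbC.
have invR s x y : s \in graph_aut e -> R x y -> R (s x) (s y).
  move=> sA /existsP[z /andP[exz eyz]]; apply/existsP; exists (s z).
  by rewrite !(graph_aut_conn _ _ sA) exz.
have fR x y : R x y -> x.1 = y.1.
  by case/existsP=> z /andP[/eE exz /eE]; rewrite exz => /addIr.
suff exR : exists x, exists2 y, R x y & x != y.
  by have := primitive_relation prim symR invR fR exR (0, 0)%R (1, 0)%R; move/eqP.
exists (0, - u)%R, (0, - v)%R; last by rewrite xpair_eqE eqxx eqr_opp.
apply/existsP; exists (1, 0)%R; apply/andP; split; apply/orP; left.
  by have := layer_step_shift (0%R : 'Z_2) (- u)%R w0 uU; rewrite expr0 mul1r addNr.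
by have := layer_step_shift (0%R : 'Z_2) (- v)%R w0 vU; rewrite expr0 mul1r addNr.
Qed.

Local Open Scope ring_scope.

(** * Gauss periods and period matrices *)

Section AdditiveCharacter.

Variables (p : nat) (z : algC).
Hypotheses (p_prime : prime p) (z_prim : p.-primitive_root z).

Definition chi (x : 'F_p) : algC := z ^+ x.

Let zp : z ^+ p = 1. Proof. exact: prim_expr_order. Qed.

Lemma chi0 : chi 0 = 1. Proof. exact: expr0. Qed.

Lemma chiD x y : chi (x + y) = chi x * chi y.
Proof.
by rewrite /chi -exprD -[RHS](expr_mod _ zp) /=; congr (z ^+ (_ %% _)); apply: Fp_cast.
Qed.

Lemma chiN x : chi (- x) = (chi x)^*.
Proof.
have z1 : `|z| = 1 by apply/eqP; rewrite -(@pexpr_eq1 _ _ p) ?prime_gt0 // -normrX zp normr1.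
have chi1 : `|chi x| = 1 by rewrite normrX z1 expr1n.
have chix0 : chi x != 0 by rewrite -normr_eq0 chi1 oner_eq0.
apply: (mulfI chix0); rewrite -chiD subrr chi0 -normCK chi1 expr1n //.
Qed.

Lemma chi_eq1 x : (chi x == 1) = (x == 0).
Proof.
rewrite /chi -(prim_order_dvd z_prim) -val_eqE /=.
have xp : (x < p)%N by rewrite -{2}(Fp_cast p_prime).
by case: (nat_of_ord x) xp => [|n] np; rewrite ?dvdn0 ?gtnNdvd.
Qed.

Lemma chi_natr k x : chi (k%:R * x) = chi x ^+ k.
Proof.
elim: k => [|k IHk]; first by rewrite mul0r chi0 expr0.
by rewrite exprS -IHk -chiD mulrS mulrDl mul1r.
Qed.

(** Translating the summation variable by 1 multiplies the sum by [chi r], which is not 1 unless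
    [r = 0]. *)
Lemma sum_chi r : \sum_x chi (r * x) = if r == 0 then p%:R else 0.
Proof.
case: eqP => [->|/eqP r0].
  rewrite (eq_bigr (fun=> 1)) => [|x _]; last by rewrite mul0r chi0.
  by rewrite sumr_const card_Fp.
have : chi r * \sum_x chi (r * x) = \sum_x chi (r * x).
  rewrite mulr_sumr [RHS](reindex_inj (addrI 1)) /=.
  by apply: eq_bigr => x _; rewrite mulrDr mulr1 chiD.
move/eqP; rewrite -subr_eq0 -[X in _ - X]mul1r -mulrBl mulf_eq0 subr_eq0 chi_eq1 (negPf r0) /=.
by move/eqP.
Qed.

(** By Fourier inversion only the coefficient at 0 contributes, so [p%:R * h c] is the same sum for
    every [c]. *)
Lemma fourier_constant (h : 'F_p -> algC) :
  (forall r, r != 0 -> \sum_b h b * chi (r * b) = 0) -> forall b c, h b = h c.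
Proof.
move=> h0; have p0 : p%:R != 0 :> algC by rewrite pnatr_eq0 -lt0n prime_gt0.
suff hE c : p%:R * h c = \sum_b h b by move=> b c; apply: (mulfI p0); rewrite !hE.
have -> : \sum_b h b = \sum_r chi (- (r * c)) * \sum_b h b * chi (r * b).
  rewrite [RHS](bigD1 0) //= mul0r oppr0 chi0 mul1r [X in _ = _ + X]big1 ?addr0.
    by apply: eq_bigr => b _; rewrite mul0r chi0 mulr1.
  by move=> r r0; rewrite h0 // mulr0.
(* Orthogonality over [r] leaves only the term [b = c]. *)
transitivity (\sum_b \sum_r h b * chi (b - c) ^+ 0 * chi ((b - c) * r)).
  rewrite (bigD1 c) //= subrr -mulr_sumr sum_chi eqxx expr0 mulr1 mulrC big1 ?addr0 //.
  by move=> b bc; rewrite -mulr_sumr sum_chi subr_eq0 (negPf bc) mulr0.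
rewrite exchange_big /=; apply: eq_bigr => r _; rewrite mulr_sumr.
apply: eq_bigr => b _; rewrite expr0 mulr1 mulrCA -chiD mulrBl addrC.
by rewrite ![_ * r]mulrC.
Qed.

Variable U : {set 'F_p}.

Definition gauss_period (r : 'F_p) : algC := \sum_(u in U) chi (r * u).

Lemma gauss_periodN r : gauss_period (- r) = (gauss_period r)^*.
Proof. by rewrite rmorph_sum; apply: eq_bigr => u _; rewrite mulNr chiN. Qed.

Lemma gauss_period0 : gauss_period 0 = #|U|%:R.
Proof.
by rewrite /gauss_period (eq_bigr (fun=> 1)) ?sumr_const // => u _; rewrite mul0r chi0.
Qed.

(** Parseval's identity for the indicator function of [U]: summing over [r] kills the pairs
    [u != v]. *)
Lemma sum_gauss_period_sqr :
  \sum_r gauss_period r * (gauss_period r)^* = (p * #|U|)%:R.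
Proof.
rewrite (eq_bigr (fun r => \sum_(u in U) \sum_(v in U) chi ((u - v) * r))); last first.
  move=> r _; rewrite -gauss_periodN mulr_suml; apply: eq_bigr => u _.
  rewrite mulr_sumr; apply: eq_bigr => v _; rewrite -chiD.
  by rewrite mulrBl mulNr ![_ * r]mulrC.
rewrite exchange_big /= (eq_bigr (fun=> p%:R)) => [|u uU].
  by rewrite sumr_const natrM mulr_natr.
rewrite exchange_big /= (bigD1 u) //= sum_chi subrr eqxx big1 ?addr0 // => v /andP[_ vu].
by rewrite sum_chi subr_eq0 eq_sym (negPf vu).
Qed.

Lemma sum_gauss_period : 0 \notin U -> \sum_r gauss_period r = 0.
Proof.
move=> U0; rewrite exchange_big big1 //= => u uU.
under eq_bigr do rewrite mulrC.
by rewrite sum_chi; case: eqP => // u0; rewrite u0 (negPf U0) in uU.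
Qed.

End AdditiveCharacter.

Section PeriodMatrix.

Variables (p q : nat) (z : algC) (w : 'F_p) (U : {set 'F_p}).
Hypotheses (p_prime : prime p) (q_gt2 : (2 < q)%N) (z_prim : p.-primitive_root z).
Hypothesis w_neq0 : w != 0.

Notation Q := (Zp_trunc q).+2.

(** The block of the adjacency operator at frequency [r], acting on row vectors. For [q > 2] at most
    one of the two indicators is nonzero. *)
Definition period_mx (r : 'F_p) : 'M[algC]_Q :=
  \matrix_(i < Q, j < Q)
    ((i == j + 1 :> 'Z_q)%:R * gauss_period z U (- (r * w ^+ j))
     + (j == i + 1 :> 'Z_q)%:R * gauss_period z U (r * w ^+ i)).

Lemma Zp_add1_neq_sub1 (j : 'Z_q) : (j + 1 == j - 1) = false.
Proof.
apply/eqP => /addrI /eqP; rewrite -subr_eq0 opprK -(natrD _ 1 1) => /eqP/(congr1 (@nat_of_ord _)).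
by rewrite (val_Zp_nat (ltnW q_gt2)) modn_small.
Qed.

Lemma Zp_neq_add1add1 (j : 'Z_q) : (j == j + 1 + 1) = false.
Proof.
by apply: contraFF (Zp_add1_neq_sub1 j) => /eqP{2}->; rewrite addrK.
Qed.

Lemma mul_period_mx (v : 'rV[algC]_Q) r (j : 'Z_q) :
  (v *m period_mx r) 0 j = v 0 (j + 1) * gauss_period z U (- (r * w ^+ j))
                         + v 0 (j - 1) * gauss_period z U (r * w ^+ (j - 1)%R).
Proof.
rewrite mxE (bigD1 (j + 1)) //= (bigD1 (j - 1)) /=; last by rewrite eq_sym Zp_add1_neq_sub1.
rewrite big1 ?addr0; last first.
  move=> i /andP[i1 i2]; rewrite mxE (negPf i1) mul0r add0r.
  have -> : (j == i + 1) = false; last by rewrite mul0r mulr0.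
  by apply: contraNF i2 => /eqP->; rewrite addrK.
rewrite !mxE eqxx subrK eqxx !mul1r.
by rewrite Zp_neq_add1add1 [j - 1 == _]eq_sym Zp_add1_neq_sub1 !mul0r addr0 add0r.
Qed.

(** For [q > 2] steps forward and backward reach different layers, so the neighbours split into two
    disjoint families, each parametrised by [U]. *)
Lemma sum_layered_graph (R : nmodType) (h : 'Z_q * 'F_p -> R) (j : 'Z_q) b :
  \sum_(y | layered_graph q w U y (j, b)) h y
  = \sum_(u in U) h (j + 1, b + w ^+ j * u)
    + \sum_(u in U) h (j - 1, b - w ^+ (j - 1)%R * u).
Proof.
have wi k : w ^+ k != 0 by rewrite expf_neq0.
have -> : \sum_(y | layered_graph q w U y (j, b)) h y
   = \sum_(y | layer_step q w U (j, b) y) h y + \sum_(y | layer_step q w U y (j, b)) h y.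
  rewrite (bigID (layer_step q w U (j, b))) /=; congr (_ + _); apply: eq_bigl => y.
    by rewrite /layered_graph /= andb_orl andbb orb_idl // => /andP[].
  rewrite /layered_graph /= andb_orl andbN orbF; apply: andb_idr => /andP[/eqP/= jy _].
  by rewrite negb_and jy Zp_neq_add1add1.
have step1 : \sum_(y | layer_step q w U (j, b) y) h y = \sum_(u in U) h (j + 1, b + w ^+ j * u).
  rewrite (reindex_onto (fun u => (j + 1, b + w ^+ j * u)) (fun y => (y.2 - b) / w ^+ j)) /=.
    apply: eq_bigl => u; rewrite /layer_step /= eqxx [b + _]addrC addrK mulrC mulKf // eqxx andbT.
    by [].
  by move=> [k c] /andP[/eqP/= -> _]; rewrite mulrC divfK // [b + _]addrC subrK.
have step2 : \sum_(y | layer_step q w U y (j, b)) h y = \sum_(u in U) h (j - 1, b - w ^+ (j - 1)%R * u).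
  rewrite (reindex_onto (fun u => (j - 1, b - w ^+ (j - 1)%R * u)) (fun y => (b - y.2) / w ^+ (j - 1)%R)) /=.
    apply: eq_bigl => u; rewrite /layer_step /= subrK eqxx opprB addrC subrK mulrC mulKf // eqxx andbT.
    by [].
  by move=> [k c] /andP[/eqP/= -> _]; rewrite addrK mulrC divfK // subKr.
exact: (congr2 +%R step1 step2).
Qed.

Definition fourier_row (h : 'Z_q * 'F_p -> algC) (r : 'F_p) : 'rV[algC]_Q :=
  \row_(j < Q) \sum_b h (j : 'Z_q, b) * chi z (r * b).

(** A substitution for [b] turns a shift by a multiple of [u] into a factor [chi]; summing over [u]
    then produces the Gauss periods. *)
Lemma fourier_eigen theta h r :
    eigenfunction (layered_graph q w U) theta h ->
  fourier_row h r *m period_mx r = theta *: fourier_row h r.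
Proof.
move=> hE; apply/rowP=> j; rewrite mul_period_mx !mxE [RHS]mulr_sumr.
under [RHS]eq_bigr do rewrite mulrA -hE sum_layered_graph mulrDl !mulr_suml.
rewrite big_split /=; congr (_ + _).
  rewrite exchange_big /= [LHS]mulr_sumr; apply: eq_bigr => u _.
  rewrite mulr_suml (reindex_inj (addIr (w ^+ j * u))) /=; apply: eq_bigr => b _.
  rewrite -mulrA -chiD //; congr (_ * chi z _); ring.
rewrite exchange_big /= [LHS]mulr_sumr; apply: eq_bigr => u _.
rewrite mulr_suml (reindex_inj (addIr (- (w ^+ (j - 1)%R * u)))) /=; apply: eq_bigr => b _.
rewrite -mulrA -chiD //; congr (_ * chi z _); ring.
Qed.

Lemma period_mx_hermitian r : period_mx r \is hermsymmx.
Proof.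
apply/is_hermitianmxP; rewrite expr0 scale1r; apply/matrixP=> i j; rewrite !mxE.
rewrite rmorphD !rmorphM /= !conjC_nat -!gauss_periodN //.
by rewrite opprK addrC.
Qed.

End PeriodMatrix.

Section CommonEigenvalues.

Variables (p q : nat) (z om : algC) (w : 'F_p) (U : {set 'F_p}).
Hypotheses (p_prime : prime p) (q_prime : prime q) (q_gt2 : (2 < q)%N).
Hypotheses (z_prim : p.-primitive_root z) (om_prim : q.-primitive_root om).
Hypotheses (w_neq0 : w != 0) (co_pq : coprime p q).

Definition cycle_eigenvalue k : algC := #|U|%:R * (om ^+ k + om ^- k).

Lemma expr_ZpD (R : pzRingType) (x : R) (j k : 'Z_q) :
  x ^+ q = 1 -> x ^+ (j + k)%R = x ^+ j * x ^+ k.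
Proof.
move=> xq; rewrite -exprD -[RHS](expr_mod _ xq) /=; congr (x ^+ (_ %% _)).
by apply: Zp_cast; apply: prime_gt1.
Qed.

Lemma om_neq0 : om != 0.
Proof. by rewrite (prim_root_eq0 om_prim) -lt0n prime_gt0. Qed.

Lemma layer_eigenfunction :
  eigenfunction (layered_graph q w U) (cycle_eigenvalue 1) (fun x => om ^+ x.1).
Proof.
have omq := prim_expr_order om_prim.
move=> [j b].
transitivity (\sum_(u in U) om ^+ (j + 1)%R + \sum_(u in U) om ^+ (j - 1)%R).
  by rewrite sum_layered_graph.
rewrite !sumr_const -mulrnDl -[LHS]mulr_natl.
rewrite !expr_ZpD // (_ : om ^+ (1 : 'Z_q)%R = om); last by case: q q_gt2 => [|[]].
have -> : om ^+ (- 1 : 'Z_q)%R = om^-1.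
  apply: (mulfI om_neq0); rewrite divff ?om_neq0 //.
  have := expr_ZpD (1 : 'Z_q) (- 1) omq; rewrite subrr expr0.
  by rewrite (_ : om ^+ (1 : 'Z_q)%R = om) //; case: q q_gt2 => [|[]].
by rewrite /cycle_eigenvalue expr1; ring.
Qed.

(** Some eigenfunction is not constant on a layer. By [fourier_constant] it has a nonzero Fourier
    row at some [r != 0], and this row is an eigenvector. *)
Lemma primitive_period_eigenvalue : vertex_primitive (layered_graph q w U) ->
  exists2 r, r != 0 & eigenvalue (period_mx q z w U r) (cycle_eigenvalue 1).
Proof.
move=> prim.
have [||g gE [x [y [eqxy neqxy]]]] :=
  @primitive_eigenfunction _ _ _ _ (fun x : 'Z_q * 'F_p => x.1) _ _ prim layer_eigenfunction.
- exists (1, 0), (0, 0); rewrite /= expr0 (_ : om ^+ (1 : 'Z_q)%R = om).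
    by rewrite -(prim_order_dvd om_prim 1) dvdn1 gtn_eqF // prime_gt1.
  by case: q q_gt2 => [|[]].
- by exists (0, 0), (0, 1).
case: (pickP (fun r => (r != 0) && (fourier_row z g r != 0))) => [r /andP[r0 gr]|g0].
  exists r => //; apply/eigenvalueP; exists (fourier_row z g r) => //.
  exact: fourier_eigen.
case/negP: neqxy; apply/eqP; move: x y eqxy => [j b] [_ c] /= <-.
apply: (fourier_constant p_prime z_prim (h := fun b => g (j, b))) => r r0.
have /negbT := g0 r; rewrite r0 negbK => /eqP/rowP/(_ j); rewrite !mxE.
exact.
Qed.

(** The Chinese remainder theorem provides an exponent [n] congruent to [t] modulo [p] and to [k]
    modulo [q]; some automorphism raises all [p * q]-th roots of unity to the power [n]. *)
Lemma gauss_period_aut (t : 'F_p) k : t != 0 -> coprime k q ->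
  exists s : {rmorphism algC -> algC},
    (forall x, s (gauss_period z U x) = gauss_period z U (t * x)) /\ s om = om ^+ k.
Proof.
move=> t0 co_kq; pose n := chinese p q t k.
have n_p : n%:R = t.
  rewrite -[RHS]natr_Zp; apply: ord_inj; rewrite !val_Fp_nat //.
  by rewrite /n chinese_modl.
have co_n : coprime n (p * q).
  rewrite coprimeMr -[coprime n q]coprime_modl /n chinese_modr // coprime_modl co_kq andbT.
  rewrite coprime_sym prime_coprime // (dvdn_pcharf (pchar_Fp p_prime)).
  by rewrite [_%:R]n_p.
have [s sE] := Qn_aut_exists co_n; exists s; split=> [x|].
  have s_z : s z = z ^+ n by apply: sE; rewrite exprM (prim_expr_order z_prim) expr1n.
  rewrite /gauss_period rmorph_sum; apply: eq_bigr => u _.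
  by rewrite -mulrA -n_p chi_natr // /chi rmorphXn /= s_z exprAC.
rewrite sE; last by rewrite mulnC exprM (prim_expr_order om_prim) expr1n.
by rewrite -(prim_expr_mod om_prim) /n chinese_modr // prim_expr_mod.
Qed.

(** The automorphism for [t = r / r0] maps one period matrix entrywise to the other, hence also the
    roots of their characteristic polynomials. *)
Lemma period_eigenvalue_conj r0 r k :
    r0 != 0 -> r != 0 -> coprime k q ->
    eigenvalue (period_mx q z w U r0) (cycle_eigenvalue 1) ->
  eigenvalue (period_mx q z w U r) (cycle_eigenvalue k).
Proof.
move=> r00 rr0 co_kq.
have [|s [s_gp s_om]] := @gauss_period_aut (r / r0) k _ co_kq.
  by rewrite mulf_neq0 ?invr_eq0.
have s_mx : map_mx s (period_mx q z w U r0) = period_mx q z w U r.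
  apply/matrixP=> i j; rewrite !mxE rmorphD !rmorphM /= !rmorph_nat !s_gp.
  by rewrite mulrN !mulrA divfK.
have s_ev : s (cycle_eigenvalue 1) = cycle_eigenvalue k.
  by rewrite /cycle_eigenvalue rmorphM rmorphD fmorphV rmorph_nat /= !expr1 s_om.
by rewrite !eigenvalue_root_char -s_mx -s_ev -map_char_poly fmorph_root.
Qed.

End CommonEigenvalues.

(** * Bounds from the eigenvalues of the period matrices *)

(** By the spectral theorem; [d] lists the eigenvalues with multiplicity. *)
Lemma hermitian_eigenvalues n (A : 'M[algC]_n) : A \is hermsymmx ->
  exists d : 'I_n -> algC,
    [/\ forall i, d i \is Num.real,
        \sum_i d i = \tr A, \sum_i d i ^+ 2 = \tr (A *m A), \prod_i d i = \det A
      & forall a, eigenvalue A a <-> exists i, a = d i].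
Proof.
move=> herm; pose d i := spectral_diag A 0 i; exists d.
have Pu := spectral_unit A; set P := spectralmx A in Pu.
have AE : A = invmx P *m diag_mx (spectral_diag A) *m P.
  exact/orthomx_spectralP/hermitian_normalmx.
split.
- by move=> i; apply: (mxOverP (hermitian_spectral_diag_real herm)).
- by rewrite AE mxtrace_mulC mulmxA mulmxV // mul1mx mxtrace_diag.
- have AA : A *m A = invmx P *m (diag_mx (spectral_diag A) *m diag_mx (spectral_diag A)) *m P.
    by rewrite {1 2}AE -!mulmxA mulKVmx.
  rewrite AA mxtrace_mulC mulKVmx // mulmx_diag mxtrace_diag.
  by apply: eq_bigr => i _; rewrite !mxE expr2.
- rewrite AE !det_mulmx det_inv mulrAC mulVf ?mul1r ?det_diag //.
  by rewrite -unitfE -unitmxE.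
move=> a; split=> [/eigenvalueP[v vA v0]|[i ->]].
  pose u := v *m invmx P.
  have u0 : u != 0 by apply: contra v0 => /eqP u0; rewrite -(mulmxKV Pu v) -/u u0 mul0mx.
  have uD : u *m diag_mx (spectral_diag A) = a *: u.
    have AP : A *m invmx P = invmx P *m diag_mx (spectral_diag A) by rewrite {1}AE mulmxK.
    by rewrite /u -mulmxA -AP mulmxA vA scalemxAl.
  have [i ui0] : exists i, u 0 i != 0.
    by apply/rV0Pn.
  exists i; apply: (mulIf ui0); have /rowP/(_ i) := uD.
  by rewrite mul_mx_diag !mxE mulrC => <-.
apply/eigenvalueP; exists (row i P).
  have PA : P *m A = diag_mx (spectral_diag A) *m P by rewrite {1}AE -mulmxA mulKVmx.
  rewrite -row_mul PA mul_diag_mx.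
  by apply/rowP=> j; rewrite !mxE.
apply/eqP=> Pi0; have /row_freeP : row_free P by rewrite row_free_unit.
case=> B PB; have /rowP/(_ i) : row i P *m B = row i 1%:M by rewrite -row_mul PB.
by rewrite Pi0 mul0mx !mxE eqxx => /esym/eqP; rewrite oner_eq0.
Qed.

(** The right side is the sum of [(d i - t) ^+ 2] over all eigenvalues. Distinct members of [s]
    occupy distinct indices, and the other terms are nonnegative because [d i] and [t] are real. *)
Lemma hermitian_trace_bound n (A : 'M[algC]_n) (s : seq algC) (t : algC) :
    A \is hermsymmx -> t \is Num.real -> uniq s -> {in s, forall x, eigenvalue A x} ->
  \sum_(x <- s) (x - t) ^+ 2 <= \tr (A *m A) - t *+ 2 * \tr A + n%:R * t ^+ 2.
Proof.
move=> herm tR us sA; have [d [dR d1 d2 _ dE]] := hermitian_eigenvalues herm.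
have -> : \tr (A *m A) - t *+ 2 * \tr A + n%:R * t ^+ 2 = \sum_i (d i - t) ^+ 2.
  rewrite (eq_bigr (fun i => d i ^+ 2 - t *+ 2 * d i + t ^+ 2)) => [|i _]; last by ring.
  by rewrite big_split sumrB -mulr_sumr sumr_const card_ord d1 d2 mulr_natl.
have sq0 i : 0 <= (d i - t) ^+ 2 by rewrite -realEsqr rpredB.
apply: (@le_trans _ _ (\sum_(x <- s) \sum_(i | d i == x) (d i - t) ^+ 2)).
  rewrite big_seq [leRHS]big_seq; apply: ler_sum => x xs.
  have /dE[i xi] := sA x xs; rewrite (bigD1 i) ?xi //= lerDl sumr_ge0 //.
rewrite (exchange_big_dep predT) //=; apply: ler_sum => i _.
rewrite -big_filter big_const_seq count_predT size_filter iter_addr_0.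
rewrite (eq_count (a2 := pred1 (d i))); last by move=> x /=; rewrite eq_sym.
by rewrite count_uniq_mem //; case: (_ \in _) => //=; rewrite mulr0n.
Qed.

Section HalfSums.

Variables (q : nat) (om : algC).
Hypotheses (q_prime : prime q) (q_odd : odd q) (om_prim : q.-primitive_root om).

Lemma sum_prim_root : \sum_(0 <= k < q) om ^+ k = 0.
Proof.
have om1 : om - 1 != 0.
  by rewrite subr_eq0 -{1}[om]expr1 -(prim_order_dvd om_prim) dvdn1 gtn_eqF ?prime_gt1.
apply: (mulfI om1); rewrite mulr0 big_mkord -subrX1 (prim_expr_order om_prim) subrr //.
Qed.

(** Since [om ^- k = om ^+ (q - k)], the pairs run through all powers of [om] other than 1. *)
Lemma half_sum_prim_root : \sum_(1 <= k < q./2.+1) (om ^+ k + om ^- k) = -1.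
Proof.
have qE : q = (q./2 + q./2).+1 by rewrite -{1}(odd_double_half q) q_odd -addnn.
have -> : \sum_(1 <= k < q./2.+1) (om ^+ k + om ^- k) = \sum_(1 <= k < q) om ^+ k.
  have Kq : (q./2.+1 <= q)%N by lia.
  rewrite [RHS](@big_cat_nat _ _ _ q./2.+1) //=.
  rewrite big_split /=; congr (_ + _).
  rewrite -[q./2.+1 in RHS]add1n big_addn.
  have -> : (q - q./2 = q./2.+1)%N by lia.
  rewrite [RHS]big_nat_rev /=.
  apply: eq_big_nat => k /andP[k1 kK].
  rewrite -[LHS]mul1r -(prim_expr_order om_prim).
  have om0 : om != 0 by rewrite (prim_root_eq0 om_prim) -lt0n prime_gt0.
  have {1}-> : q = (1 + q./2.+1 - k.+1 + q./2 + k)%N by lia.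
  by rewrite exprD mulfK // expf_neq0.
have := sum_prim_root; rewrite big_ltn ?prime_gt0 // expr0 => /eqP.
by rewrite addrC addr_eq0 => /eqP.
Qed.

End HalfSums.

(** Each square is the corresponding pair for [om ^+ 2] plus 2, and [om ^+ 2] is again primitive as
    [q] is odd: the sum is -1 + (q - 1). *)
Lemma half_sum_prim_root_sqr q (om : algC) :
    prime q -> odd q -> q.-primitive_root om ->
  \sum_(1 <= k < q./2.+1) (om ^+ k + om ^- k) ^+ 2 = (q - 2)%:R.
Proof.
move=> q_prime q_odd om_prim.
have om0 : om != 0 by rewrite (prim_root_eq0 om_prim) -lt0n prime_gt0.
have om2_prim : q.-primitive_root (om ^+ 2).
  by rewrite prim_root_exp_coprime // coprime_sym coprimen2.
rewrite (eq_bigr (fun k => ((om ^+ 2) ^+ k + (om ^+ 2) ^- k) + 2%:R)) => [|k _]; last first.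
  rewrite sqrrD -exprVn -exprMn divff // expr1n -!exprM [(2 * k)%N]mulnC !exprM.
  by rewrite -!exprVn [RHS]addrAC.
rewrite big_split /= half_sum_prim_root // sumr_const_nat subn1 /=.
have qE : q = (q./2 + q./2).+1 by rewrite -{1}(odd_double_half q) q_odd -addnn.
have q3 : (2 < q)%N by apply: odd_prime_gt2.
rewrite -[2%:R *+ _]mulr_natr -natrM addrC.
have -> : (q - 2 = 2 * q./2 - 1)%N by lia.
by rewrite natrB //; lia.
Qed.

(** The difference of two values has the factors [om ^+ j - om ^+ k] and [1 - om ^- (j + k)], and
    [0 < j + k < q]. *)
Lemma cycle_eigenvalue_uniq p q (om : algC) (U : {set 'F_p}) :
    prime q -> odd q -> q.-primitive_root om -> (0 < #|U|)%N ->
  uniq [seq cycle_eigenvalue om U k | k <- index_iota 1 q./2.+1].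
Proof.
move=> q_prime q_odd om_prim U0; rewrite map_inj_in_uniq ?iota_uniq // => j k.
rewrite !mem_index_iota => /andP[j0 jK] /andP[k0 kK].
have om0 : om != 0 by rewrite (prim_root_eq0 om_prim) -lt0n prime_gt0.
have omX n : om ^+ n != 0 by rewrite expf_neq0.
move/mulfI; rewrite pnatr_eq0 -lt0n => /(_ U0) /eqP; rewrite -subr_eq0.
have -> : om ^+ j + om ^- j - (om ^+ k + om ^- k)
   = (om ^+ j - om ^+ k) * (1 - (om ^+ (j + k))^-1).
  by rewrite exprD; field; rewrite !omX.
have qE : q = (q./2 + q./2).+1 by rewrite -{1}(odd_double_half q) q_odd -addnn.
rewrite mulf_eq0 !subr_eq0 => /orP[|].
  have jq : (j < q)%N by lia.
  have kq : (k < q)%N by lia.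
  by rewrite (eq_prim_root_expr om_prim) !modn_small // => /eqP.
rewrite eq_sym invr_eq1 -(prim_order_dvd om_prim) gtnNdvd //; lia.
Qed.

Section TraceBound.

Variables (p q : nat) (z om : algC) (w : 'F_p) (U : {set 'F_p}).
Hypotheses (p_prime : prime p) (q_prime : prime q) (q_odd : odd q).
Hypotheses (z_prim : p.-primitive_root z) (om_prim : q.-primitive_root om).
Hypotheses (w_neq0 : w != 0).

Let q_gt2 : (2 < q)%N. Proof. exact: odd_prime_gt2. Qed.

Lemma period_mx_trace r : \tr (period_mx q z w U r) = 0.
Proof.
apply: big1 => j _; rewrite mxE.
have -> : (j == j + 1 :> 'Z_q) = false.
  by rewrite -[X in X == _]addr0 (inj_eq (addrI _)) eq_sym oner_eq0.
by rewrite !mul0r addr0.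
Qed.

(** Diagonal entry [j] of the square adds the squared moduli of the weights of the two edges at [j];
    each edge is counted twice. *)
Lemma period_mx_sqr_trace r : \tr (period_mx q z w U r *m period_mx q z w U r)
  = (\sum_(j : 'Z_q) gauss_period z U (r * w ^+ j) * (gauss_period z U (r * w ^+ j))^*) *+ 2.
Proof.
pose g (j : 'Z_q) := gauss_period z U (r * w ^+ j) * (gauss_period z U (r * w ^+ j))^*.
have diagE (j : 'Z_q) : (period_mx q z w U r *m period_mx q z w U r) j j = g j + g (j - 1).
  have -> : (period_mx q z w U r *m period_mx q z w U r) j j
    = (row j (period_mx q z w U r) *m period_mx q z w U r) 0 j by rewrite -row_mul [RHS]mxE.
  rewrite mul_period_mx // !mxE eqxx subrK eqxx Zp_neq_add1add1 // [j - 1 == _]eq_sym.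
  rewrite Zp_add1_neq_sub1 // !mul0r add0r addr0 !mul1r !gauss_periodN //.
  by rewrite [X in _ + X]mulrC.
rewrite /mxtrace (eq_bigr _ (fun j _ => diagE j)) big_split /= mulr2n; congr (_ + _).
by rewrite [RHS](reindex_inj (addIr (-1 : 'Z_q))).
Qed.

End TraceBound.

Section Bounds.

Variables (p q : nat) (z om : algC) (w : 'F_p) (U : {set 'F_p}).
Hypotheses (p_prime : prime p) (q_prime : prime q) (q_odd : odd q).
Hypotheses (z_prim : p.-primitive_root z) (om_prim : q.-primitive_root om).
Hypotheses (w_neq0 : w != 0) (U_gt0 : (0 < #|U|)%N).
Hypothesis M_eigen : forall r k, r != 0 -> (0 < k < q)%N ->
  eigenvalue (period_mx q z w U r) (cycle_eigenvalue om U k).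

Notation K := (q./2).
Notation l := #|U|.

(** Multiplication by [w ^+ j] permutes the nonzero [r], so each layer contributes Parseval's sum
    without its term at 0. *)
Lemma sum_period_mx_sqr_trace :
  \sum_(r | r != 0) \tr (period_mx q z w U r *m period_mx q z w U r)
  = 2%:R * q%:R * l%:R * (p%:R - l%:R).
Proof.
have q_gt2 := odd_prime_gt2 q_odd q_prime.
under eq_bigr do rewrite period_mx_sqr_trace //.
rewrite sumrMnl exchange_big /=.
pose g (r : 'F_p) := gauss_period z U r * (gauss_period z U r)^*.
have gE (j : 'Z_q) : \sum_(r | r != 0) g (r * w ^+ j) = p%:R * l%:R - l%:R * l%:R.
  have wj : w ^+ j != 0 by rewrite expf_neq0.
  have -> : \sum_(r | r != 0) g (r * w ^+ j) = \sum_(r | r != 0) g r.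
    rewrite [RHS](reindex_inj (mulIf wj)) /=; apply: eq_bigl => r.
    by rewrite mulf_eq0 (negPf wj) orbF.
  have := sum_gauss_period_sqr p_prime z_prim U; rewrite natrM (bigD1 0) //= => <-.
  by rewrite gauss_period0 // conjC_nat addrAC subrr add0r.
rewrite (eq_bigr _ (fun j _ => gE j)) sumr_const card_ord.
have -> : (Zp_trunc q).+2 = q by rewrite Zp_cast ?prime_gt1.
rewrite -[_ *+ q]mulr_natl; ring.
Qed.

(** Every [M_r] with [r != 0] has trace 0 and [K] distinct known eigenvalues, with sum [-l] and sum
    of squares [l ^ 2 (q - 2)]. The other [K + 1] eigenvalues have mean [l / (K + 1)], the shift [t]
    below. The resulting lower bound for the trace of [M_r ^ 2] is summed over [r] and compared with
    the exact total. *)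
Lemma period_trace_bound :
  (p.-1 * l * K + 2 * l * K.+1 <= 2 * p * K.+1)%N.
Proof.
have q_gt2 := odd_prime_gt2 q_odd q_prime.
have qE : q = K.*2.+1 by rewrite -{1}(odd_double_half q) q_odd.
have Kq : (K.+1 <= q)%N by lia.
have [k1 k1E] : exists k1 : algC, k1 = K.+1%:R by eexists.
have [lC lCE] : exists lC : algC, lC = l%:R by eexists.
have k1_neq0 : k1 != 0 by rewrite k1E pnatr_eq0.
(* This shift makes the resulting bound optimal. *)
pose t := lC / k1.
have tR : t \is Num.real by rewrite /t k1E lCE realM ?realV ?realn.
have kC : K%:R = k1 - 1 by rewrite k1E -natr1 addrK.
pose s := [seq cycle_eigenvalue om U k | k <- index_iota 1 K.+1].
have qC : q%:R = 2%:R * k1 - 1 :> algC.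
  by rewrite qE -addn1 -muln2 natrD natrM kC; ring.
have sumE : \sum_(x <- s) (x - t) ^+ 2
    = lC ^+ 2 * (q%:R - 2%:R) + 2%:R * t * lC + (k1 - 1) * t ^+ 2.
  rewrite big_map (eq_bigr (fun k => lC ^+ 2 * (om ^+ k + om ^- k) ^+ 2
     - 2%:R * t * lC * (om ^+ k + om ^- k) + t ^+ 2)) => [|k _]; last first.
    by rewrite /cycle_eigenvalue -lCE; ring.
  rewrite big_split sumrB /= -!mulr_sumr half_sum_prim_root // half_sum_prim_root_sqr //.
  rewrite sumr_const_nat (_ : (K.+1 - 1 = K)%N) ?subn1 // natrB 1?ltnW // -[_ *+ K]mulr_natl.
  by rewrite kC /t; field.
have Q_q : (Zp_trunc q).+2%:R = q%:R :> algC by rewrite Zp_cast ?prime_gt1.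
have sM r : r != 0 -> \sum_(x <- s) (x - t) ^+ 2 - q%:R * t ^+ 2
    <= \tr (period_mx q z w U r *m period_mx q z w U r).
  move=> r0; rewrite lerBlDr.
  have := @hermitian_trace_bound _ (period_mx q z w U r) s t.
  rewrite period_mx_trace mulr0 subr0 Q_q; apply=> //.
  - exact: period_mx_hermitian.
  - rewrite /s; apply: cycle_eigenvalue_uniq => //.
  - move=> _ /mapP[k + ->]; rewrite mem_index_iota => kK.
    by apply: M_eigen => //; case/andP: kK => -> kK; apply: leq_trans kK Kq.
have : \sum_(r : 'F_p | r != 0) (\sum_(x <- s) (x - t) ^+ 2 - q%:R * t ^+ 2)
       <= 2%:R * q%:R * l%:R * (p%:R - l%:R).
  by rewrite -sum_period_mx_sqr_trace; apply: ler_sum.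
have card_nz : #|[pred r : 'F_p | r != 0]| = p.-1.
  have -> : p.-1 = #|'F_p|.-1 by rewrite card_Fp.
  by rewrite -(cardC1 (0 : 'F_p)).
rewrite sumr_const card_nz sumE -[_ *+ _]mulr_natl -lCE.
have lq0 : 0 < lC * q%:R / k1.
  have lC0 : 0 < lC by rewrite lCE ltr0n.
  have k10 : 0 < k1 by rewrite k1E ltr0n.
  have q0 : 0 < q%:R :> algC by rewrite ltr0n prime_gt0.
  by rewrite divr_gt0 ?mulr_gt0.
set L := (X in X <= _); set Rr := (X in _ <= X).
have -> : L = lC * q%:R / k1 * (p.-1%:R * lC * (k1 - 1)).
  by rewrite /L /t qC; field.
have -> : Rr = lC * q%:R / k1 * (2%:R * k1 * (p%:R - lC)).
  by rewrite /Rr; field.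
rewrite ler_pM2l // => ineq.
rewrite -(ler_nat algC) natrD !natrM -lCE -k1E.
rewrite kC -lerBrDr; apply: le_trans ineq _.
by rewrite [leRHS](_ : _ = 2%:R * k1 * (p%:R - lC)) //; ring.
Qed.

End Bounds.

(** This gives access to the transitivity of integrality, used in [Aint_root_monic]. *)
Lemma Aint_integralOver x : x \in Aint <-> integralOver (intmul (1 : algC)) x.
Proof.
split=> [xA|[f f_monic fx]]; last first.
  apply: root_monic_Aint fx _ _; first exact: monic_map.
  by apply/polyOverP=> i; rewrite coef_map intr_int.
have [f fE] := floorpP xA; exists f; last by rewrite -fE root_minCpoly.
have := minCpoly_monic x; rewrite fE !monicE lead_coef_map_inj //; last exact: intr_inj.
by rewrite -[X in _ == X -> _]/(1%:~R) eqr_int.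
Qed.

Lemma Aint_root_monic (f : {poly algC}) x :
  f \is monic -> f \is a polyOver Aint -> root f x -> x \in Aint.
Proof.
move=> f_monic fA fx; apply/Aint_integralOver; apply: integral_root_monic f_monic fx _.
by apply/integral_poly => i; apply/Aint_integralOver/(polyOverP fA).
Qed.

Lemma eigenvalue_Aint n (A : 'M[algC]_n) a :
  (forall i j, A i j \in Aint) -> eigenvalue A a -> a \in Aint.
Proof.
move=> AA; rewrite eigenvalue_root_char; apply: Aint_root_monic (char_poly_monic A) _.
apply: rpred_sum => s _; rewrite rpredMsign; apply: rpred_prod => i _.
by rewrite !mxE rpredB ?rpredMn ?polyOverX ?polyOverC.
Qed.

(** Such an [x] would be 1/2, but a rational algebraic integer is an integer. *)
Lemma two_not_Aint_unit x : x \in Aint -> 2%:R * x = 1 -> False.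
Proof.
move=> xA x2; have xE : x = 2%:R^-1.
  by apply: (mulfI (_ : 2%:R != 0)); rewrite ?pnatr_eq0 // x2 divff ?pnatr_eq0.
have /intrP[k xk] : x \in Num.int.
  by apply: Cint_rat_Aint xA; rewrite xE rpredV rpred_nat.
move: x2; rewrite xk -[2%:R]/(2%:~R) -intrM -[X in _ = X]/(1%:~R) => /intr_inj; lia.
Qed.

Section PeriodDeterminant.

Variables (p q : nat) (z : algC) (w : 'F_p) (U : {set 'F_p}).
Hypotheses (p_prime : prime p) (q_prime : prime q) (q_odd : odd q).
Hypotheses (z_prim : p.-primitive_root z) (w_neq0 : w != 0).
Hypothesis U_opp : forall u, (- u \in U) = (u \in U).

Let q_gt2 : (2 < q)%N. Proof. exact: odd_prime_gt2. Qed.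

Lemma gauss_period_opp x : gauss_period z U (- x) = gauss_period z U x.
Proof.
rewrite /gauss_period [RHS](reindex_inj oppr_inj) /=.
by apply: eq_big => u; rewrite ?U_opp // mulrN mulNr.
Qed.

Let shift_inj (d : 'Z_q) : injective (fun i : 'Z_q => i + d). Proof. exact: addIr. Qed.
Let shift (d : 'Z_q) : {perm 'Z_q} := perm (@shift_inj d).

(** If [s 0 = d], injectivity forces the move [+ d] at 2d, then at 4d, and so on; as [q] is odd, the
    multiples of 2d exhaust ['Z_q]. The condition [d * d = 1] treats both signs at once. *)
Lemma perm_neighbours (s : {perm 'Z_q}) :
  (forall i, (s i == i + 1) || (s i == i - 1)) -> s = shift 1 \/ s = shift (-1).
Proof.
move=> s1; suff main d : d * d = 1 -> (forall i, (s i == i + d) || (s i == i - d)) ->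
    s 0 = d -> s = shift d.
  have /orP[/eqP|/eqP] := s1 0; rewrite add0r => s0; [left|right]; apply: main => //.
    by rewrite mulr1.
    by rewrite mulrNN mulr1.
  by move=> i; rewrite opprK orbC.
move=> dd sd s0; have dd2 : d + d != 0.
  apply/eqP => d2; have := Zp_add1_neq_sub1 q_gt2 (d * d * 0); rewrite dd.
  rewrite mul1r add0r sub0r => /eqP[]; apply/eqP; rewrite -subr_eq0 opprK -dd -mulrDl d2 mul0r //.
have sn n : s ((d + d) *+ n) = (d + d) *+ n + d.
  elim: n => [|n IHn]; first by rewrite mulr0n add0r.
  have /orP[/eqP//|/eqP eqs] := sd ((d + d) *+ n.+1).
  move: eqs; rewrite {2}mulrSr -addrA [_ - d]addrK -IHn => /perm_inj /eqP.
  by rewrite mulrSr -subr_eq0 addrAC subrr add0r (negPf dd2).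
apply/permP=> j; rewrite permE /=.
(* [q.+1./2] is the inverse of 2 modulo [q], and [d] is its own inverse. *)
have -> : j = (d + d) *+ (q.+1./2 * nat_of_ord (d * j)%R)%N; last by [].
rewrite mulrnA -mulr2n -[d *+ 2 *+ _]mulrnA mul2n even_halfK; last by rewrite /= q_odd.
rewrite mulrS -[d *+ q]mulr_natr pchar_Zp ?prime_gt1 // mulr0 addr0.
by rewrite -mulr_natr natr_Zp mulrA dd mul1r.
Qed.

(* For odd q the only closed covers of the q-cycle by moves +1 and -1 are the two
   rotations. *)
Lemma det_period_mx r : exists b : bool,
  \det (period_mx q z w U r)
  = (-1) ^+ b * (2%:R * \prod_(j : 'Z_q) gauss_period z U (r * w ^+ j)).
Proof.
exists (odd_perm (shift 1)).
have neq : shift (-1) != shift 1.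
  apply/eqP=> /permP/(_ 0); rewrite !permE /= => /eqP.
  by rewrite eq_sym Zp_add1_neq_sub1.
rewrite /determinant (bigD1 (shift 1)) //= (bigD1 (shift (-1))) //=.
rewrite [X in _ + (_ + X)]big1 => [|s /andP[s1 s2]]; last first.
  have /forallPn[i] : ~~ [forall i : 'Z_q, (s i == i + 1) || (s i == i - 1)].
    apply/negP=> /forallP /perm_neighbours[] /eqP; first by rewrite (negPf s1).
    by rewrite (negPf s2).
  rewrite negb_or => /andP[si1 si2]; rewrite (bigD1 i) //= mxE.
  rewrite (negPf si1).
  have -> : (i == s i + 1) = false.
    by apply: contraNF si2 => /eqP eqi; rewrite [X in _ == X - 1]eqi addrK.
  by rewrite !mul0r addr0 mul0r mulr0.
(* The two rotations are mutually inverse and so have the same sign; their products agree because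
   the Gauss periods are even functions. *)
have odd_eq : odd_perm (shift (-1)) = odd_perm (shift 1).
  rewrite -odd_permV; congr odd_perm; apply: (mulgI (shift (-1))); rewrite mulgV.
  by apply/permP=> j; rewrite permM perm1 !permE /= subrK.
rewrite addr0 odd_eq -mulrDr; congr (_ * _); rewrite mulr_natl mulr2n; congr (_ + _).
  apply: eq_bigr => j _; rewrite mxE permE /= eqxx mul1r.
  by rewrite Zp_neq_add1add1 // mul0r add0r.
rewrite [RHS](reindex_inj (addIr (-1 : 'Z_q))) /=.
apply: eq_bigr => j _; rewrite mxE permE /= subrK eqxx mul1r [j - 1 == _]eq_sym.
by rewrite Zp_add1_neq_sub1 // mul0r addr0 gauss_period_opp.
Qed.

End PeriodDeterminant.

(** The inverse is 1 + x^2 + x^4 + ... + x^(n-1): multiplied by x^2 - 1 it gives x^(n+1) - 1 = x -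
    1. *)
Lemma unity_root_add1_unit n (x : algC) : odd n -> x ^+ n = 1 -> x != 1 ->
  exists2 y, y \in Aint & (1 + x) * y = 1.
Proof.
move=> n_odd xn x1; have n_gt0 : (0 < n)%N by case: n n_odd {xn}.
exists (\sum_(i < n.+1./2) (x ^+ 2) ^+ i).
  apply: rpred_sum => i _; rewrite rpredX // rpredX //.
  by apply: (Aint_unity_root n_gt0); apply/unity_rootP.
apply: (@mulIf _ (x - 1)); first by rewrite subr_eq0.
rewrite mul1r mulrAC [1 + x]addrC -[_ * (x - 1)]mulrC -subr_sqr_1 -subrX1.
by rewrite -exprM mul2n even_halfK ?[odd _]/= ?negbK ?n_odd // exprS xn mulr1.
Qed.

Section SmallCases.

Variables (p q : nat) (z om : algC) (w : 'F_p) (U : {set 'F_p}).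
Hypotheses (p_prime : prime p) (q_prime : prime q) (q_odd : odd q).
Hypotheses (z_prim : p.-primitive_root z) (om_prim : q.-primitive_root om).
Hypotheses (w_neq0 : w != 0) (co_pq : coprime p q).
Hypothesis M_eigen : forall r k, r != 0 -> (0 < k < q)%N ->
  eigenvalue (period_mx q z w U r) (cycle_eigenvalue om U k).

(* Each cycle eigenvalue is divisible by 2, hence 4 divides the determinant
   of the period matrix; but that determinant is 2 times a unit. *)
Lemma period_sign_absurd : odd p -> U = [set 1; -1] -> (3 < q)%N -> False.
Proof.
move=> p_odd UE q_gt3.
have q_gt2 := ltnW q_gt3.
have one_opp : (1 : 'F_p) != -1.
  rewrite -subr_eq0 opprK -(natrD _ 1 1) -(dvdn_pcharf (pchar_Fp p_prime)).
  by rewrite gtnNdvd // odd_prime_gt2.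
have cardU : #|U| = 2%N by rewrite UE cards2 one_opp.
have U_opp u : (- u \in U) = (u \in U) by rewrite UE !inE eqr_opp eqr_oppLR orbC.
have chiA x : chi z x \in Aint by rewrite rpredX // (Aint_prim_root z_prim).
have gpA x : gauss_period z U x \in Aint by rewrite rpred_sum.
(* The Gauss period is [chi x + chi (- x)], that is [chi (- x)] times [1 + chi (x + x)]. *)
have gp_unit x : x != 0 -> exists2 y, y \in Aint & gauss_period z U x * y = 1.
  move=> x0; have [||y yA yE] := @unity_root_add1_unit p (chi z (x + x)) p_odd.
  - by rewrite -exprM mulnC exprM (prim_expr_order z_prim) expr1n.
  - rewrite chi_eq1 // -mulr2n -mulr_natl mulf_eq0 (negPf x0) orbF.
    by rewrite -(dvdn_pcharf (pchar_Fp p_prime)) gtnNdvd // odd_prime_gt2.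
  exists (chi z x * y); first by rewrite rpredM.
  rewrite /gauss_period UE big_setU1 ?inE //= big_set1 mulr1 mulrN1 mulrA mulrDl -!chiD //.
  by rewrite addNr chi0 [_ + 1]addrC.
have MA i j : period_mx q z w U 1 i j \in Aint.
  by rewrite mxE rpredD // rpredM ?rpred_nat.
have herm : period_mx q z w U 1 \is hermsymmx by apply: period_mx_hermitian.
have [d [_ _ _ detE dE]] := hermitian_eigenvalues herm.
have dA i : d i \in Aint by apply: (eigenvalue_Aint MA); apply/dE; exists i.
have om0 : om != 0 by rewrite (prim_root_eq0 om_prim) -lt0n prime_gt0.
have ev k : (0 < k < q)%N -> exists i, exists2 y, y \in Aint &
    d i = 2%:R * y /\ d i = cycle_eigenvalue om U k.
  move=> kq; have /dE[i di] := M_eigen (oner_neq0 _) kq.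
  exists i; exists (om ^+ k + om ^- k); last by rewrite -di /cycle_eigenvalue cardU.
  have omA : om \in Aint by apply: Aint_prim_root om_prim.
  rewrite rpredD ?rpredX // -exprVn rpredX //; apply: (Aint_unity_root (prime_gt0 q_prime)).
  by apply/unity_rootP; rewrite exprVn (prim_expr_order om_prim) invr1.
have [|i1 [y1 y1A [d1 e1]]] := ev 1%N; first by rewrite /= ltnW.
have [|i2 [y2 y2A [d2 e2]]] := ev 2%N; first by rewrite /=.
(* As [q > 3], both 1 and 2 lie in the range on which the cycle eigenvalues are distinct. *)
have i12 : i2 != i1.
  apply: contraTneq (@cycle_eigenvalue_uniq p q om U q_prime q_odd om_prim _) => [eqi|].
    have K2 : (1 < q./2)%N := half_leq q_gt3.
    rewrite /index_iota subn1 /=; case: (q./2) K2 => [|[|K]] //= _.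
    by rewrite inE -e1 -e2 eqi eqxx.
  by rewrite cardU.
have [b bE] := det_period_mx z w q_prime q_odd U_opp 1.
pose X := \prod_(j : 'Z_q) gauss_period z U (1 * w ^+ j).
have [Y YA XY] : exists2 Y, Y \in Aint & X * Y = 1.
  rewrite /X; elim/big_rec: _ => [|j x _ [Y YA XY]]; first by exists 1; rewrite ?rpred1 ?mulr1.
  have [|y yA yE] := gp_unit (1 * w ^+ j); first by rewrite mul1r expf_neq0.
  by exists (y * Y); rewrite ?rpredM // mulrACA yE XY mulr1.
pose D := \prod_(i | (i != i1) && (i != i2)) d i.
have DA : D \in Aint by apply: rpred_prod.
have : 2%:R * y1 * (2%:R * y2) * D = (-1) ^+ b * (2%:R * X).
  by rewrite -bE -detE (bigD1 i1) // (bigD1 i2) //= -d1 -d2 mulrA.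
move/(congr1 (fun x => (-1) ^+ b * x)); rewrite [RHS]mulrA -signr_addb addbb mul1r => eqX.
have eqX' : 2%:R * ((-1) ^+ b * y1 * y2 * D) = X.
  apply: (mulfI (_ : 2%:R != 0)); rewrite ?pnatr_eq0 // -eqX; ring.
apply: (@two_not_Aint_unit ((-1) ^+ b * y1 * y2 * D * Y)).
  by rewrite !rpredM // rpredX // rpredN rpred1.
by rewrite mulrA eqX'.
Qed.

(* When U contains the cube roots of unity, the period matrix is a circulant
   with eigenvalues a om^k + conj(a) om^-k; if -3 is one of them for every r,
   the real parts of the Gauss periods have the wrong average. *)
Lemma period_cube_absurd : q = 3%N -> #|U| = 3%N -> 0 \notin U -> (3 < p)%N ->
  (forall u, (w * u \in U) = (u \in U)) -> False.
Proof.
move=> q3 cardU U0 p_gt3 wU.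
have q_gt2 : (2 < q)%N by rewrite q3.
have isT1 : (0 < 1 < q)%N by rewrite q3.
pose a r := gauss_period z U r.
have aw r (j : nat) : a (r * w ^+ j) = a r.
  elim: j => [|j IHj]; first by rewrite mulr1.
  rewrite exprSr mulrA -IHj /a /gauss_period [RHS](reindex_inj (mulfI w_neq0)) /=.
  by apply: eq_big => u; rewrite ?wU // mulrA.
have om3 : om ^+ 3 = 1 by rewrite -q3 (prim_expr_order om_prim).
have om_sum : om ^+ 2 = -1 - om.
  have := sum_prim_root q_prime om_prim; rewrite q3 !big_nat_recr //= big_geq //.
  rewrite add0r expr0 expr1 => /eqP; rewrite addrC addr_eq0 => /eqP ->; ring.
have omV : om^-1 = om ^+ 2.
  have om0 : om != 0 by rewrite (prim_root_eq0 om_prim) -lt0n prime_gt0.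
  by apply: (mulfI om0); rewrite divff // -exprS.
have theta1 : cycle_eigenvalue om U 1 = -3%:R.
  by rewrite /cycle_eigenvalue cardU expr1 omV om_sum; ring.
have circ r : r != 0 ->
    [\/ a r + (a r)^* = -3%:R, om * a r + om ^+ 2 * (a r)^* = -3%:R
      | om ^+ 2 * a r + om * (a r)^* = -3%:R].
  move=> r0; have /eigenvalueP[v vM v0] := M_eigen r0 (isT1 : (0 < 1 < q)%N).
  have eqv (j : 'Z_q) : v 0 (j + 1) * (a r)^* + v 0 (j - 1) * a r = - 3%:R * v 0 j.
    have /rowP/(_ j) := vM; rewrite mul_period_mx // gauss_periodN // -/(a _) -/(a _) !aw.
    by rewrite theta1 mxE.
  have Z3 : 1 + 1 + 1 = 0 :> 'Z_q.
    transitivity (q%:R : 'Z_q); last exact: pchar_Zp (ltnW q_gt2).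
    by rewrite -[1 + 1](natrD _ 1 1) -(natrD _ 2 1); congr (_%:R).
  have e0 := eqv 0; have e1 := eqv 1; have e2 := eqv (1 + 1).
  have m1 : - 1 = 1 + 1 :> 'Z_q by rewrite -[LHS]add0r -Z3 addrK.
  rewrite add0r sub0r m1 in e0; rewrite subrr in e1.
  rewrite Z3 addrK in e2.
  set x0 := v 0 0 in e0 e1 e2; set x1 := v 0 1 in e0 e1 e2; set x2 := v 0 (1 + 1) in e0 e1 e2.
  (* The eigenvector is tested against the three characters of ['Z_3]. Each coefficient times the
     matching factor vanishes, and the coefficients are not all 0. *)
  have f0 : (x0 + x1 + x2) * (a r + (a r)^* + 3%:R) = 0.
    transitivity ((x1 * (a r)^* + x2 * a r + 3%:R * x0) + (x2 * (a r)^* + x0 * a r + 3%:R * x1)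
      + (x0 * (a r)^* + x1 * a r + 3%:R * x2)); first by ring.
    by rewrite e0 e1 e2; ring.
  have f1 : (x0 + om * x1 + om ^+ 2 * x2) * (om * a r + om ^+ 2 * (a r)^* + 3%:R) = 0.
    transitivity ((x1 * (a r)^* + x2 * a r + 3%:R * x0) + om * (x2 * (a r)^* + x0 * a r + 3%:R * x1)
      + om ^+ 2 * (x0 * (a r)^* + x1 * a r + 3%:R * x2)); first by ring: om_sum.
    by rewrite e0 e1 e2; ring.
  have f2 : (x0 + om ^+ 2 * x1 + om * x2) * (om ^+ 2 * a r + om * (a r)^* + 3%:R) = 0.
    transitivity ((x1 * (a r)^* + x2 * a r + 3%:R * x0) + om ^+ 2 * (x2 * (a r)^* + x0 * a r + 3%:R * x1)
      + om * (x0 * (a r)^* + x1 * a r + 3%:R * x2)); first by ring: om_sum.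
    by rewrite e0 e1 e2; ring.
  have [c0|c0] := eqVneq (x0 + x1 + x2) 0; last first.
    by constructor 1; apply/eqP; rewrite -addr_eq0; apply/eqP/(mulfI c0); rewrite f0 mulr0.
  have [c1|c1] := eqVneq (x0 + om * x1 + om ^+ 2 * x2) 0; last first.
    by constructor 2; apply/eqP; rewrite -addr_eq0; apply/eqP/(mulfI c1); rewrite f1 mulr0.
  have [c2|c2] := eqVneq (x0 + om ^+ 2 * x1 + om * x2) 0; last first.
    by constructor 3; apply/eqP; rewrite -addr_eq0; apply/eqP/(mulfI c2); rewrite f2 mulr0.
  have three0 : 3%:R != 0 :> algC by rewrite pnatr_eq0.
  have x00 : x0 = 0.
    apply: (mulfI three0); rewrite mulr0.
    transitivity ((x0 + x1 + x2) + (x0 + om * x1 + om ^+ 2 * x2)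
      + (x0 + om ^+ 2 * x1 + om * x2)); first by ring: om_sum.
    by rewrite c0 c1 c2; ring.
  have x10 : x1 = 0.
    apply: (mulfI three0); rewrite mulr0.
    transitivity ((x0 + x1 + x2) + om ^+ 2 * (x0 + om * x1 + om ^+ 2 * x2)
      + om * (x0 + om ^+ 2 * x1 + om * x2)); first by ring: om_sum.
    by rewrite c0 c1 c2; ring.
  have x20 : x2 = 0 by rewrite -c0 x00 x10; ring.
  case/eqP: v0; apply/rowP=> j; rewrite mxE -[j](natr_Zp (j : 'Z_q)).
  have jq : (j < q)%N by have := ltn_ord j; rewrite [X in (_ < X)%N](Zp_cast (ltnW q_gt2)).
  have : (j < 3)%N by apply: leq_trans jq _; rewrite q3.
  by case: (nat_of_ord j) => [|[|[|//]]] _; rewrite ?x00 ?x10 ?x20.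
have conj_sum r : r != 0 -> a r + (a r)^* = -3%:R.
  move=> r0; have co2 : coprime 2 q by rewrite q3.
  (* [s] fixes the Gauss periods and squares [om]. Adding one of the last two equations of [circ] to
     its image gives [a r + (a r)^* = 6], which fails because 6 minus the left side is a sum of
     squares [|1 - chi (r * u)|^2] with nonzero terms. *)
  have [s [sa som]] := @gauss_period_aut p q z om U p_prime z_prim om_prim co_pq 1 2 (oner_neq0 _) co2.
  have sar : s (a r) = a r by rewrite /a sa mul1r.
  have sarC : s ((a r)^*) = (a r)^* by rewrite /a -gauss_periodN // sa mul1r.
  have no6 : a r + (a r)^* != 6%:R.
    rewrite -subr_eq0 -oppr_eq0 opprB.
    have -> : 6%:R - (a r + (a r)^*)
        = \sum_(u in U) (1 - chi z (r * u)) * (1 - chi z (r * u))^*.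
      rewrite (eq_bigr (fun u => 2%:R - (chi z (r * u) + (chi z (r * u))^*))) => [|u _].
        rewrite sumrB sumr_const cardU big_split /= -rmorph_sum /=.
        by rewrite -[2%:R *+ 3]mulrnA.
      have cc : chi z (r * u) * (chi z (r * u))^* = 1 by rewrite -chiN // -chiD // subrr chi0.
      by rewrite rmorphB rmorph1 /=; ring: cc.
    apply/eqP=> sum0; have /card_gt0P[u uU] : (0 < #|U|)%N by rewrite cardU.
    have := psumr_eq0P (fun u _ => mul_conjC_ge0 (1 - chi z (r * u))) sum0 uU.
    move/eqP; rewrite mul_conjC_eq0 subr_eq0 eq_sym chi_eq1 // mulf_eq0 (negPf r0) /= => /eqP u0.
    by rewrite u0 (negPf U0) in uU.
  have sar3 : s (-3%:R) = -3%:R by rewrite rmorphN rmorph_nat.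
  case: (circ r r0) => [//|e1|e1]; case/negP: no6; apply/eqP.
    have := congr1 s e1; rewrite rmorphD !rmorphM ?rmorphXn /= sar sarC som sar3 => e2.
    have -> : a r + (a r)^* = - (-3%:R) - (-3%:R) by rewrite -{1}e1 -e2; ring: om_sum.
    by ring.
  have := congr1 s e1; rewrite rmorphD !rmorphM ?rmorphXn /= sar sarC som sar3 => e2.
  have -> : a r + (a r)^* = - (-3%:R) - (-3%:R) by rewrite -{1}e1 -e2; ring: om_sum.
  by ring.
(* The total would be -3 (p - 1) by [conj_sum], so [p] would be 3. *)
have : \sum_(r | r != 0) (a r + (a r)^*) = - 6%:R.
  have := sum_gauss_period p_prime z_prim U0; rewrite (bigD1 0) //= gauss_period0 // cardU.
  move/eqP; rewrite addrC addr_eq0 => /eqP sum_a.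
  rewrite big_split /= -rmorph_sum /= sum_a rmorphN rmorph_nat; ring.
rewrite (eq_bigr _ conj_sum) sumr_const.
have -> : #|[pred r : 'F_p | r != 0]| = p.-1.
  have -> : p.-1 = #|'F_p|.-1 by rewrite card_Fp.
  by rewrite -(cardC1 (0 : 'F_p)).
rewrite mulNrn => /oppr_inj; rewrite -mulrnA => /eqP; rewrite eqr_nat; lia.
Qed.

End SmallCases.

Lemma unit_cycle2 p (a : {unit 'F_p}) : prime p -> #[a]%g = 2%N ->
  [set val u | u in <[a]>%g] = [set 1; -1] :> {set 'F_p}.
Proof.
move=> p_prime a2; apply/eqP; rewrite eqEcard; apply/andP; split.
  apply/subsetP=> _ /imsetP[u ua ->]; rewrite !inE -eqf_sqr expr1n.
  have /(congr1 val) : (u ^+ 2)%g = 1%g.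
    by apply/eqP; rewrite -order_dvdn -a2 order_dvdG.
  by rewrite expgS expg1 /= -expr2 => ->.
rewrite card_imset; last exact: val_inj.
by rewrite -[X in (_ <= X)%N]/(#[a]%g) a2 cards2; case: (_ != _).
Qed.

Lemma primitive_layered_order p q (W a : {unit 'F_p}) :
    prime p -> prime q -> odd q -> coprime p q ->
    cyclic [set: {unit 'F_p}] -> #[W]%g = q -> (1 < #[a]%g)%N ->
    vertex_primitive (layered_graph q (val W) [set val u | u in <[a]>%g]) ->
  q = 3%N /\ #[a]%g = 2%N.
Proof.
move=> p_prime q_prime q_odd co_pq cycU W_q a_gt1 prim.
have p_gt0 := prime_gt0 p_prime.
have [z z_prim] := C_prim_root_exists p_gt0.
have [om om_prim] := C_prim_root_exists (prime_gt0 q_prime).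
have q_gt2 := odd_prime_gt2 q_odd q_prime.
have w_neq0 : val W != 0 by apply/eqP => W0; have := valP W; rewrite W0 unitr0.
set U := [set val u | u in <[a]>%g] in prim *; set w := val W in w_neq0 prim.
have cardU : #|U| = #[a]%g by rewrite card_imset //; exact: val_inj.
have a_le : (#[a]%g <= p.-1)%N.
  have -> : p.-1 = #|[set: {unit 'F_p}]| by rewrite card_finField_unit card_Fp.
  by apply: subset_leq_card; apply/subsetP=> u _; rewrite inE.
have [r0 r00 ev0] := primitive_period_eigenvalue p_prime q_prime q_gt2 z_prim om_prim w_neq0 prim.
have M_eigen r k : r != 0 -> (0 < k < q)%N ->
    eigenvalue (period_mx q z w U r) (cycle_eigenvalue om U k).
  move=> r_neq0 /andP[k0 kq]; apply: (period_eigenvalue_conj p_prime z_prim om_prim co_pq r00) => //.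
  by rewrite coprime_sym prime_coprime // gtnNdvd.
have U_gt0 : (0 < #|U|)%N by rewrite cardU ltnW.
have bound := period_trace_bound p_prime q_prime q_odd z_prim om_prim w_neq0 U_gt0 M_eigen.
rewrite cardU in bound.
have [q3|q_neq3] := eqVneq q 3%N.
  (* For [q = 3] the bound reads l (p + 3) <= 4 p. *)
  split=> //; have : (#[a]%g <= 3)%N.
    by rewrite q3 /= in bound; move: bound a_gt1; set l := #[a]%g; clear; nia.
  rewrite leq_eqVlt => /orP[/eqP a3|]; last first.
    by rewrite ltnS => a_le2; apply/eqP; rewrite eqn_leq a_gt1 a_le2.
  case: (@period_cube_absurd p q z om w U p_prime q_prime q_odd z_prim om_prim w_neq0 co_pq M_eigen) => //.
  - by rewrite cardU.
  - by apply/imsetP=> -[u _] u0; have := valP u; rewrite -u0 unitr0.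
  - by move: a_le; rewrite a3 -ltnS prednK.
  (* A cyclic group has only one subgroup of order 3. *)
  have Wa : W \in <[a]>%g.
    have /eqP <- : <[W]>%g == <[a]>%g :> {set _}; last exact: cycle_id.
    by rewrite (eq_subG_cyclic cycU) ?subsetT // -!orderE W_q a3 q3.
  move=> u; apply/imsetP/imsetP => -[v va vE].
    exists (W^-1 * v)%g; first by rewrite groupM ?groupV.
    by rewrite FinRing.val_unitM -vE FinRing.val_unitV mulKf.
  by exists (W * v)%g; rewrite ?groupM // FinRing.val_unitM -vE.
have q_gt3 : (3 < q)%N by rewrite ltn_neqAle eq_sym q_neq3.
have K2 : (2 <= q./2)%N := half_leq q_gt3.
have a2 : #[a]%g = 2%N.
  (* With l >= 3 the bound would give (p - 1) (K - 2) + 4 (K + 1) <= 0. *)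
  move: bound K2 a_gt1 p_gt0; set l := #[a]%g; set K := q./2; clear => bound K2 l1 p0.
  apply/eqP; rewrite eqn_leq l1 andbT leqNgt; apply/negP=> l3.
  move: bound; rewrite -{2}(prednK p0); set P := p.-1; nia.
have p_odd : odd p.
  have [p2|//] := even_prime p_prime.
  by move: a_le; rewrite a2 p2.
by case: (@period_sign_absurd p q z om w U p_prime q_prime q_odd z_prim om_prim w_neq0 M_eigen) => //;
  apply: unit_cycle2.
Qed.

(** * Hexagons in the case q = 3, l = 2 *)

Section Hexagons.

Variables (p : nat) (w : 'F_p).
Hypotheses (p_prime : prime p) (p_odd : odd p) (w2 : w ^+ 2 = -1 - w).

Notation V := ('Z_3 * 'F_p)%type.
Notation e := (layered_graph 3 w [set 1; -1]).

(* The two values of t distinguish the two triangles through a vertex. *)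
Definition kagome_step (t d : bool) (x : V) : V :=
  if d then (x.1 + 1, x.2 + (-1) ^+ t * w ^+ x.1)
  else (x.1 - 1, x.2 - (-1) ^+ t * w ^+ (x.1 - 1)%R).

Let w3 : w ^+ 3 = 1. Proof. by ring: w2. Qed.

Let w_neq0 : w != 0.
Proof. by apply/eqP => w0; move: w3; rewrite w0 expr0n => /esym/eqP; rewrite oner_eq0. Qed.

Let wS (j : 'Z_3) : w ^+ (j + 1)%R = w ^+ j * w.
Proof. by rewrite (@expr_ZpD 3). Qed.

Let wP (j : 'Z_3) : w ^+ (j - 1)%R = w ^+ j * w ^+ 2.
Proof. by rewrite (@expr_ZpD 3). Qed.

Lemma kagome_upE t j b : kagome_step t true (j, b) = (j + 1, b + (-1) ^+ t * w ^+ j).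
Proof. by []. Qed.

Lemma kagome_downE t j b :
  kagome_step t false (j, b) = (j - 1, b - (-1) ^+ t * (w ^+ j * w ^+ 2)).
Proof. by rewrite -wP. Qed.

Lemma kagome_down_up t x : kagome_step t false (kagome_step t true x) = x.
Proof.
case: x => j b; congr (_, _); first exact: addrK.
rewrite -[RHS](addrK ((-1) ^+ t * w ^+ j)).
by congr (_ - _ * w ^+ nat_of_ord _); apply: addrK.
Qed.

Lemma kagome_up_down t x : kagome_step t true (kagome_step t false x) = x.
Proof. by case: x => j b; congr (_, _); apply: subrK. Qed.

Lemma kagome_adj x y : reflect (exists t d, y = kagome_step t d x) (e x y).
Proof.
have wj (j : 'Z_3) : w ^+ j != 0 by rewrite expf_neq0.
have stepE (x' y' : V) : layer_step 3 w [set 1; -1] x' y' <->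
    exists t : bool, y' = (x'.1 + 1, x'.2 + (-1) ^+ t * w ^+ x'.1).
  split=> [/andP[/eqP y1 y2]|[t ->]].
    have [t tE] : exists t : bool, (y'.2 - x'.2) / w ^+ x'.1 = (-1) ^+ t.
      by move: y2; rewrite !inE => /orP[] /eqP ->; [exists false | exists true].
    exists t; rewrite -tE divfK // [x'.2 + _]addrC subrK -y1; by case: (y').
  rewrite /layer_step /= eqxx /= [x'.2 + _]addrC addrK mulfK // !inE.
  by case: t; rewrite eqxx ?orbT.
have layer_stepP (x' y' : V) : layer_step 3 w [set 1; -1] x' y' <->
    exists t : bool, y' = kagome_step t true x' by apply: stepE.
apply: (iffP orP) => [[/layer_stepP[t ->]|/layer_stepP[t ->]]|[t [[] ->]]].
- by exists t, true.
- by exists t, false; rewrite kagome_down_up.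
- by left; apply/layer_stepP; exists t.
by right; apply/layer_stepP; exists t; rewrite kagome_up_down.
Qed.

(** Since 1 + w + w^2 = 0, three steps up with the same [t] close a triangle. *)
Lemma kagome_triangle t d1 d2 x : let y := kagome_step t d2 (kagome_step t d1 x) in
  x = y \/ e x y.
Proof.
have Z3 (j : 'Z_3) : j + 1 + 1 = j - 1 by rewrite -addrA; congr (j + _); apply: val_inj.
have Z3' (j : 'Z_3) : j - 1 - 1 = j + 1 by rewrite -addrA; congr (j + _); apply: val_inj.
case: d1 d2 => [] []; rewrite ?kagome_down_up ?kagome_up_down; try by left.
  right; apply/kagome_adj; exists t, false; case: x => j b.
  by rewrite !kagome_upE kagome_downE Z3 wS; congr (_, _); ring: w2.
right; apply/kagome_adj; exists t, true; case: x => j b.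
by rewrite !kagome_downE kagome_upE Z3' wP; congr (_, _); ring: w2.
Qed.

(** The end lies two layers up, so it could only be reached by a step down; comparing displacements
    would give 2 = 0 or 2 w = 0. *)
Lemma kagome_straight t x :
  let y := kagome_step (~~ t) true (kagome_step t true x) in x != y /\ ~~ e x y.
Proof.
have two0 : 2%:R != 0 :> 'F_p.
  by rewrite -(dvdn_pcharf (pchar_Fp p_prime)) gtnNdvd // odd_prime_gt2.
case: x => j b; rewrite !kagome_upE; split.
  by rewrite xpair_eqE negb_and -addrA -[X in X == _ + _]addr0 (inj_eq (addrI _)).
apply/kagome_adj=> -[t' [[]]].
  rewrite kagome_upE => eqV; have /addIr/eqP : j + 1 + 1 = j + 1 := congr1 fst eqV.
  by rewrite -[X in _ == X]addr0 (inj_eq (addrI _)).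
rewrite kagome_downE wS signrN => /(congr1 snd)/= /eqP; rewrite -subr_eq0.
have wj : w ^+ j != 0 by rewrite expf_neq0.
have -> : b + (-1) ^+ t * w ^+ j + - (-1) ^+ t * (w ^+ j * w)
    - (b - (-1) ^+ t' * (w ^+ j * w ^+ 2))
  = w ^+ j * ((-1) ^+ t * (1 - w) - (-1) ^+ t' * (1 + w)).
  by ring: w2.
rewrite mulf_eq0 (negPf wj) /=.
have two_w : 2%:R * w != 0 by rewrite mulf_neq0.
case: t; case: t'; rewrite ?expr0 ?expr1 ?mulN1r ?mul1r => /eqP h.
- by case/eqP: two_w; rewrite -h; ring.
- by case/eqP: two0; rewrite -[RHS]oppr0 -h; ring.
- by case/eqP: two0; rewrite -h; ring.
by case/eqP: two_w; rewrite -[RHS]oppr0 -h; ring.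
Qed.

Fixpoint kagome_walk t ds x :=
  if ds is d :: ds' then kagome_walk (~~ t) ds' (kagome_step t d x) else x.

(* The pair (a, b) stands for a + b w, where w ^ 2 = -1 - w. *)
Definition eisenstein_val (c : int * int) : 'F_p := c.1%:~R + c.2%:~R * w.
Definition eisenstein_rot (c : int * int) : int * int := (- c.2, c.1 - c.2).

(** A step down counts as 2, its residue modulo 3, to stay within the natural numbers. *)
Fixpoint walk_shift (ds : seq bool) : nat :=
  if ds is d :: ds' then ((if d then 1 else 2) + walk_shift ds')%N else 0%N.

(* Displacement of a walk, in units of (-1) ^ t w ^ j if it starts in layer j. *)
Fixpoint walk_disp (ds : seq bool) : int * int :=
  if ds is d :: ds' then
    if d then (1, 0) - eisenstein_rot (walk_disp ds')
    else - eisenstein_rot (eisenstein_rot ((1, 0) + walk_disp ds'))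
  else 0.

Lemma kagome_walkE t ds x :
  kagome_walk t ds x
  = (x.1 + (walk_shift ds)%:R, x.2 + (-1) ^+ t * w ^+ x.1 * eisenstein_val (walk_disp ds)).
Proof.
have rotE c : eisenstein_val (eisenstein_rot c) = w * eisenstein_val c.
  by rewrite /eisenstein_val /= rmorphN rmorphB /=; ring: w2.
have valD c c' : eisenstein_val (c + c') = eisenstein_val c + eisenstein_val c'.
  by rewrite /eisenstein_val /= !rmorphD; ring.
have val0 : eisenstein_val 0 = 0 by rewrite /eisenstein_val mul0r addr0.
have valN c : eisenstein_val (- c) = - eisenstein_val c.
  by apply/eqP; rewrite -addr_eq0 -valD addNr val0.
have val1 : eisenstein_val (1, 0) = 1 by rewrite /eisenstein_val mul0r addr0.
elim: ds t x => [|d ds IHds] t [j b]; first by rewrite val0 mulr0 !addr0.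
rewrite [LHS]IHds signrN; case: d.
  rewrite kagome_upE [walk_disp (_ :: _)]/= [walk_shift (_ :: _)]/= natrD valD valN val1 rotE.
  congr (_, _); first by rewrite addrA.
  by rewrite [(_, _).1]/= wS /=; ring.
rewrite kagome_downE [walk_disp (_ :: _)]/= [walk_shift (_ :: _)]/= natrD valN !rotE valD val1; congr (_, _).
  by rewrite addrA; congr (_ + _ + _); apply: val_inj.
by rewrite [(_, _).1]/= wP /=; ring.
Qed.

(** Multiply by the conjugate a + b w^2 = a - b - b w. *)
Lemma eisenstein_norm c : eisenstein_val c = 0 ->
  (c.1 ^+ 2 - c.1 * c.2 + c.2 ^+ 2)%:~R = 0 :> 'F_p.
Proof.
case: c => a b /= ab0.
transitivity (eisenstein_val (a, b) * (a%:~R - b%:~R - b%:~R * w)); last by rewrite ab0 mul0r.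
by rewrite /eisenstein_val /= rmorphD rmorphB !rmorphXn rmorphM /=; ring: w2.
Qed.

(* Non-adjacency at distance two forces consecutive edges into different
   triangles, so that the sign t alternates along the hexagon. *)
Definition hexagon (x v1 v2 y v4 v5 : V) :=
  [&& e x v1, e v1 v2, e v2 y, e y v4, e v4 v5 & e v5 x] &&
  [&& (x != v2) && ~~ e x v2, (v1 != y) && ~~ e v1 y, (v2 != v4) && ~~ e v2 v4,
      (y != v5) && ~~ e y v5, (v4 != x) && ~~ e v4 x & (v5 != v1) && ~~ e v5 v1].

Definition opposite : rel V := fun x y =>
  [exists v1, exists v2, exists v4, exists v5, hexagon x v1 v2 y v4 v5].

Lemma opposite_sym : symmetric opposite.
Proof.
suff half x y : opposite x y -> opposite y x by move=> x y; apply/idP/idP => /half.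
case/existsP=> v1 /existsP[v2 /existsP[v4 /existsP[v5]]].
rewrite /hexagon => /andP[/and5P[h1 h2 h3 h4 /andP[h5 h6]] /and5P[k1 k2 k3 k4 /andP[k5 k6]]].
apply/existsP; exists v4; apply/existsP; exists v5; apply/existsP; exists v1; apply/existsP; exists v2.
by rewrite /hexagon h1 h2 h3 h4 h5 h6 k1 k2 k3 k4 k5 k6.
Qed.

Lemma opposite_aut s x y : s \in graph_aut e -> opposite x y -> opposite (s x) (s y).
Proof.
move=> sA /existsP[v1 /existsP[v2 /existsP[v4 /existsP[v5]]]] hex.
apply/existsP; exists (s v1); apply/existsP; exists (s v2).
apply/existsP; exists (s v4); apply/existsP; exists (s v5).
by rewrite /hexagon !(graph_aut_conn _ _ sA) !(inj_eq perm_inj).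
Qed.

Lemma hexagon_walk x v1 v2 y v4 v5 : hexagon x v1 v2 y v4 v5 ->
  exists t d1 d2 d3 d4 d5 d6,
    y = kagome_walk t [:: d1; d2; d3] x /\ x = kagome_walk t [:: d1; d2; d3; d4; d5; d6] x.
Proof.
have turn t1 t2 d1 d2 u v : v = kagome_step t2 d2 (kagome_step t1 d1 u) ->
    (u != v) && ~~ e u v -> t2 = ~~ t1.
  move=> vE /andP[/eqP uv euv]; have [t12|] := eqVneq t2 t1; last by case: (t1) (t2) => [] [].
  rewrite t12 in vE; have := kagome_triangle t1 d1 d2 u; cbv zeta.
  by rewrite -vE (negPf euv) => -[].
case/andP=> /and5P[] /kagome_adj[t1 [d1 e1]] /kagome_adj[t2 [d2 e2]] /kagome_adj[t3 [d3 e3]].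
move=> /kagome_adj[t4 [d4 e4]] /andP[/kagome_adj[t5 [d5 e5]] /kagome_adj[t6 [d6 e6]]].
case/and5P=> k1 k2 k3 k4 /andP[k5 k6].
exists t1, d1, d2, d3, d4, d5, d6.
rewrite e1 in e2; have t2E := turn _ _ _ _ _ _ e2 k1; rewrite -e1 in e2.
rewrite e2 in e3; have t3E := turn _ _ _ _ _ _ e3 k2; rewrite -e2 in e3.
rewrite e3 in e4; have t4E := turn _ _ _ _ _ _ e4 k3; rewrite -e3 in e4.
rewrite e4 in e5; have t5E := turn _ _ _ _ _ _ e5 k4; rewrite -e4 in e5.
have t6E : t6 = ~~ t5 by apply: (turn _ _ d5 d6 v4 x) => //; rewrite -e5.
by rewrite /= -t2E -t3E -t4E -t5E -t6E -e1 -e2 -e3 -e4 -e5 -e6.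
Qed.

(** Exhaustion over the 64 words of directions. The walks in question return to their layer but have
    their midpoint in another one. *)
Lemma hexagon_norm d1 d2 d3 d4 d5 d6 :
    let ds := [:: d1; d2; d3; d4; d5; d6] in
    (3 %| walk_shift ds)%N -> ~~ (3 %| walk_shift [:: d1; d2; d3])%N ->
  let c := walk_disp ds in
  c.1 ^+ 2 - c.1 * c.2 + c.2 ^+ 2 \in [:: 4%:Z; 12%:Z; 16%:Z; 28%:Z; 36%:Z].
Proof.
by case: d1 d2 d3 d4 d5 d6 => [] [] [] [] [] [].
Qed.

Lemma opposite_layer x y : p != 3%N -> p != 7%N -> opposite x y -> x.1 = y.1.
Proof.
move=> p3 p7 /existsP[v1 /existsP[v2 /existsP[v4 /existsP[v5]]]].
case/hexagon_walk => t [d1 [d2 [d3 [d4 [d5 [d6 [-> ]]]]]]].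
rewrite !kagome_walkE => xE; rewrite [RHS]/=.
have shift0 : (walk_shift [:: d1; d2; d3; d4; d5; d6])%:R = 0 :> 'Z_3.
  by have /(congr1 fst)/= := xE; rewrite -[LHS]addr0 => /addrI.
have disp0 : eisenstein_val (walk_disp [:: d1; d2; d3; d4; d5; d6]) = 0.
  have tw0 : (-1) ^+ t * w ^+ x.1 != 0 by rewrite mulf_neq0 ?signr_eq0 ?expf_neq0.
  apply: (mulfI tw0); rewrite mulr0; have /(congr1 snd) := xE.
  by rewrite [snd _]/= => eqx; apply: (addrI x.2); rewrite addr0 [RHS]eqx.
have Z3 n : (n%:R == 0 :> 'Z_3) = (3 %| n)%N by rewrite -val_eqE /= val_Zp_nat.
apply/eqP; rewrite -subr_eq0 opprD addrA subrr add0r oppr_eq0 Z3; apply/negPn/negP => no3.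
move/eqP: shift0; rewrite Z3 => /hexagon_norm/(_ no3); cbv zeta.
have := eisenstein_norm disp0; move: (_ - _ + _) => N N0 N_in.
(* 1008 is the least common multiple of the five norms; its prime factors are 2, 3 and 7. *)
have [n nN n1008] : exists2 n : nat, N = n%:Z & (n %| 1008)%N.
  by move: N_in; rewrite !inE => /or4P[|||/orP[|]] /eqP ->; eexists.
have : (p %| 1008)%N.
  apply: dvdn_trans n1008; rewrite (dvdn_pcharf (pchar_Fp p_prime)); apply/eqP.
  by rewrite -[RHS]N0 nN.
move=> p1008; have : p \in primes 1008 by rewrite mem_primes p_prime.
rewrite (_ : primes 1008 = [:: 2; 3; 7]%N) // !inE (negPf p3) (negPf p7) orbF orbF.
by move/eqP=> p2; move: p_odd; rewrite p2.
Qed.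

(** A hexagonal face: six steps up with alternating [t] have displacement 0, and three of them have
    displacement -2 w, which is not 0. *)
Lemma opposite_exists : exists x, exists2 y, opposite x y & x != y.
Proof.
pose v0 : V := (0, 0); pose v1 := kagome_step false true v0.
pose v2 := kagome_step true true v1; pose v3 := kagome_step false true v2.
pose v4 := kagome_step true true v3; pose v5 := kagome_step false true v4.
have v6 : kagome_step true true v5 = v0.
  transitivity (kagome_walk false (nseq 6 true) v0); first by [].
  rewrite kagome_walkE (_ : walk_disp _ = 0) // /eisenstein_val mul0r addr0 mulr0 add0r.
  by congr (_, _); apply: val_inj.
have adj t x : e x (kagome_step t true x) by apply/kagome_adj; exists t, true.
have far t x : let y := kagome_step (~~ t) true (kagome_step t true x) in
    (x != y) && ~~ e x y by apply/andP; apply: kagome_straight.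
exists v0, v3.
  apply/existsP; exists v1; apply/existsP; exists v2.
  apply/existsP; exists v4; apply/existsP; exists v5.
  apply/andP; split; first by rewrite !adj -{1}v6 adj.
  rewrite (far false v0) (far true v1) (far false v2) (far true v3).
  have -> : (v4 != v0) && ~~ e v4 v0 by rewrite -v6; apply: (far false v4).
  by rewrite /v1 -v6; apply: (far true v5).
have -> : v3 = kagome_walk false (nseq 3 true) v0 by [].
rewrite kagome_walkE.
rewrite xpair_eqE negb_and; apply/orP; right; rewrite eq_sym add0r.
rewrite (_ : walk_disp _ = (0, -2%:R)) // /eisenstein_val add0r mulf_neq0 ?signr_eq0 ?expf_neq0 //.
rewrite mulf_neq0 // rmorphN oppr_eq0 /= -(dvdn_pcharf (pchar_Fp p_prime)).
by rewrite gtnNdvd // odd_prime_gt2.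
Qed.

Lemma primitive_kagome : vertex_primitive e -> p != 3%N -> p = 7%N.
Proof.
move=> prim p3; apply/eqP/negPn/negP => p7.
have := primitive_relation prim opposite_sym opposite_aut
  (fun x y => @opposite_layer x y p3 p7) opposite_exists (0, 0) (1, 0).
by move/eqP.
Qed.

End Hexagons.

Local Close Scope ring_scope.

(** * The flag graph of the Fano plane *)

(* The 21 flags of the Fano plane as the numbers 3 P + c, where the point P of
   Z_7 lies on the line P + D_c for the perfect difference set D = {0, 1, 3};
   line L thus consists of the points L, L - 1 and L - 3. *)
Definition flag_point (n : nat) := n %/ 3.
Definition flag_line (n : nat) := (n %/ 3 + nth 0 [:: 0; 1; 3]%N (n %% 3)) %% 7.

Definition flag_table : seq (seq nat) := Eval vm_compute in
  [seq [seq m <- iota 0 21 | (n != m) &&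
         ((flag_point n == flag_point m) || (flag_line n == flag_line m))]
  | n <- iota 0 21].

Definition flag_nbrs n := nth [::] flag_table n.
Definition flag_adj n m := m \in flag_nbrs n.

Definition flag_graph : rel 'I_21 := fun x y => flag_adj x y.

Lemma all_ordP n (Q : pred nat) : all Q (iota 0 n) -> forall x : 'I_n, Q x.
Proof. by move/allP=> h x; apply: h; rewrite mem_iota add0n ltn_ord. Qed.

Lemma all_ord2P n (Q : nat -> nat -> bool) :
  all (fun i => all (Q i) (iota 0 n)) (iota 0 n) -> forall x y : 'I_n, Q x y.
Proof. by move=> h x; apply: all_ordP; apply: (all_ordP h). Qed.

Definition flag_adj2 n m := has (fun k => flag_adj k m) (flag_nbrs n).

Lemma flag_adj2_aut s (x y : 'I_21) : s \in graph_aut flag_graph ->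
  flag_adj2 (s x) (s y) = flag_adj2 x y.
Proof.
have nbrs21 : all (fun n => all (gtn 21) (flag_nbrs n)) (iota 0 21) by [].
have adj2E (u v : 'I_21) : flag_adj2 u v = [exists k, flag_graph u k && flag_graph k v].
  apply/hasP/existsP => [[k uk kv]|[k /andP[uk kv]]]; last by exists (k : nat).
  have k21 : k < 21 by apply: (allP (all_ordP nbrs21 u)).
  by exists (Ordinal k21); apply/andP.
move=> sA; rewrite !adj2E; apply/existsP/existsP => [[k]|[k kuv]].
  by rewrite -{1 2}[k](permKV s) !(graph_aut_conn _ _ sA); exists (s^-1 k).
by exists (s k); rewrite !(graph_aut_conn _ _ sA).
Qed.

(* An automorphism fixing K pointwise fixes every vertex that is determined by its
   relations to K. *)
Definition same_sig K x y :=
  all (fun u => (flag_adj u y == flag_adj u x) && (flag_adj2 u y == flag_adj2 u x)) K.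

Definition refine K :=
  [seq x <- iota 0 21 | all (fun y => same_sig K x y ==> (y == x)) (iota 0 21)].

Lemma refine_fixed s (K : seq nat) : s \in graph_aut flag_graph ->
    (forall x : 'I_21, nat_of_ord x \in K -> s x = x) -> all (gtn 21) K ->
  forall x : 'I_21, nat_of_ord x \in refine K -> s x = x.
Proof.
move=> sA sK K21 x; rewrite mem_filter => /andP[/allP/(_ (s x)) + _].
rewrite mem_iota ltn_ord => /(_ isT)/implyP sx; apply/val_inj/eqP/sx.
apply/allP=> u uK; have u21 : u < 21 by apply: (allP K21).
pose v := Ordinal u21; have sv : s v = v by apply: sK.
have := graph_aut_conn v x sA; have := flag_adj2_aut v x sA; rewrite sv /= => -> /=.
by rewrite eqxx andbT => h; apply/eqP; apply: h.
Qed.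

(** The induced path 14, 0, 1, 3, listed with its middle edge first. *)
Definition flag_base : seq nat := [:: 0; 1; 14; 3]%N.

(** Two rounds of [refine] reach all 21 flags. *)
Lemma flag_base_fixed s : s \in graph_aut flag_graph ->
  (forall x : 'I_21, nat_of_ord x \in flag_base -> s x = x) -> s = 1.
Proof.
move=> sA s_base; have K21 : all (gtn 21) (refine flag_base).
  by apply/allP=> x; rewrite mem_filter mem_iota => /andP[].
have := refine_fixed sA (refine_fixed sA s_base isT) K21 => sE.
apply/permP=> x; rewrite perm1; apply: sE.
by apply: (@all_ordP 21 (fun n => n \in refine (refine flag_base))).
Qed.

(** The candidates for the image of [flag_base]: an edge [a b], a further neighbour [c] of [a] and
    one [d] of [b], which makes 21 * 4 * 2 * 2 = 336. *)
Definition flag_frames : seq (nat * nat * nat * nat) :=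
  let I := iota 0 21 in
  [seq (abc.1.1, abc.1.2, abc.2, d)
  | abc <- [seq (ab.1, ab.2, c)
           | ab <- [seq (a, b) | a <- I, b <- [seq b <- I | flag_adj a b]],
             c <- [seq c <- I | flag_adj ab.1 c && ~~ flag_adj ab.2 c & ab.2 != c]],
    d <- [seq d <- I | flag_adj abc.1.2 d && ~~ flag_adj abc.1.1 d & abc.1.1 != d]].

Lemma card_flag_aut_le : #|graph_aut flag_graph| <= 336.
Proof.
have fr336 : size flag_frames = 336 by [].
pose o k (k21 : k < 21) : 'I_21 := Ordinal k21.
pose fr (s : {perm 'I_21}) : nat * nat * nat * nat :=
  (s (@o 0 isT) : nat, s (@o 1%N isT) : nat, s (@o 14 isT) : nat, s (@o 3 isT) : nat).
rewrite cardE -fr336 -(size_map fr); apply: uniq_leq_size.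
  rewrite map_inj_in_uniq ?enum_uniq // => s t; rewrite !mem_enum => sA tA [e0 e1 e14 e3].
  apply/eqP; rewrite eq_mulgV1; apply/eqP/flag_base_fixed.
    by rewrite (groupM (sA : s \in graph_aut_group _)) ?groupV.
  have tV k (k21 : k < 21) : s (o k k21) = t (o k k21) :> nat -> (s * t^-1) (o k k21) = o k k21.
    by move/val_inj=> st; rewrite permM st permK.
  move=> x; rewrite !inE => /or4P[] /eqP xE; (have -> : x = o _ (ltn_ord x) by apply: val_inj);
    apply: tV; rewrite [o _ _](_ : _ = x); try exact: val_inj.
  - by rewrite (_ : x = @o 0 isT) ?e0 //; apply: val_inj.
  - by rewrite (_ : x = @o 1%N isT) ?e1 //; apply: val_inj.
  - by rewrite (_ : x = @o 14 isT) ?e14 //; apply: val_inj.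
  - by rewrite (_ : x = @o 3 isT) ?e3 //; apply: val_inj.
move=> _ /mapP[s + ->]; rewrite mem_enum => sA.
have adjE (x y : 'I_21) : flag_adj (s x) (s y) = flag_adj x y by apply: graph_aut_conn sA.
have neqE (x y : 'I_21) : (s x != s y :> nat) = (x != y :> nat).
  by rewrite !(inj_eq val_inj) (inj_eq perm_inj).
have sI (x : 'I_21) : (s x : nat) \in iota 0 21 by rewrite mem_iota ltn_ord.
have frP a b c d : [/\ a \in iota 0 21, b \in iota 0 21, c \in iota 0 21 & d \in iota 0 21] ->
    [&& flag_adj a b, flag_adj a c && ~~ flag_adj b c, b != c,
        flag_adj b d && ~~ flag_adj a d & a != d] -> (a, b, c, d) \in flag_frames.
  case=> aI bI cI dI /and5P[ab ac bc bd ad].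
  apply/allpairsPdep; exists (a, b, c), d; split; last by [].
    apply/allpairsPdep; exists (a, b), c; split; last by [].
      by apply/allpairsPdep; exists a, b; split; rewrite // mem_filter ab.
    by rewrite mem_filter ac bc.
  by rewrite mem_filter bd ad.
by apply: frP; rewrite ?sI // !adjE !neqE.
Qed.

Lemma Fp_nat_eq p n m : prime p -> (n%:R == m%:R :> 'F_p)%R = (n == m %[mod p]).
Proof. by move=> p_prime; rewrite -(inj_eq (@ord_inj _)) !val_Fp_nat. Qed.

(** Steps on natural representatives; the sign -1 is handled by exchanging sides, which avoids
    subtraction. *)
Definition kagome_step_nat (w : nat) (x y : nat * nat) :=
  (y.1 == x.1.+1 %[mod 3]) &&
  ((y.2 == x.2 + w ^ x.1 %[mod 7]) || (x.2 == y.2 + w ^ x.1 %[mod 7])).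

Lemma layer_step_nat w (x y : 'Z_3 * 'F_7) : coprime w 7 ->
  layer_step 3 (w%:R)%R [set 1; -1]%R x y
  = kagome_step_nat w (x.1 : nat, x.2 : nat) (y.1 : nat, y.2 : nat).
Proof.
move=> w7; have w0 : (w%:R != 0 :> 'F_7)%R.
  by rewrite -(dvdn_pcharf (pchar_Fp (isT : prime 7))) -prime_coprime // coprime_sym.
case: x y => [j b] [k c]; rewrite /layer_step /kagome_step_nat /=; congr (_ && _).
  by case: j k => [[|[|[|//]]] ?] [[|[|[|//]]] ?].
have wj : (w%:R ^+ j != 0 :> 'F_7)%R by rewrite expf_neq0.
rewrite !inE (can2_eq (divfK wj) (mulfK wj)) [in X in _ || X](can2_eq (divfK wj) (mulfK wj)).
rewrite mul1r mulN1r -!Fp_nat_eq // !natrD !natrX !natr_Zp; congr (_ || _).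
  by rewrite subr_eq addrC.
by rewrite subr_eq addrC eq_sym subr_eq.
Qed.

(* Entry 7 j + b is the flag of the two triangles containing (j, b), the two kinds
   of triangles being the points and the lines, for w = 2 and w = 4 respectively. *)
Definition kagome_table2 := [:: 1; 4; 7; 10; 13; 16; 19; 20; 2; 5; 8; 11; 14; 17; 12; 15; 18; 0; 3; 6; 9]%N.
Definition kagome_table4 := [:: 2; 20; 17; 14; 11; 8; 5; 4; 1; 19; 16; 13; 10; 7; 15; 12; 9; 6; 3; 0; 18]%N.

Lemma kagome_table_iso (w : nat) (t : seq nat) :
    coprime w 7 -> uniq t -> size t = 21 -> all (gtn 21) t ->
    (forall j b k c, j < 3 -> b < 7 -> k < 3 -> c < 7 ->
      flag_adj (nth 0 t (7 * j + b)) (nth 0 t (7 * k + c))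
      = kagome_step_nat w (j, b) (k, c) || kagome_step_nat w (k, c) (j, b)) ->
  graph_iso (layered_graph 3 (w%:R : 'F_7)%R [set 1; -1]%R) flag_graph.
Proof.
move=> w7 t_uniq t21 t_lt adjE.
have code_lt (x : 'Z_3 * 'F_7) : 7 * x.1 + x.2 < 21.
  case: x => [j b] /=; have j3 : j < 3 := ltn_ord j; have b7 : b < 7 := ltn_ord b; lia.
have nth_lt (x : 'Z_3 * 'F_7) : nth 0 t (7 * x.1 + x.2) < 21.
  by apply: (allP t_lt); rewrite mem_nth ?t21.
exists (fun x => Ordinal (nth_lt x)); last first.
  move=> x y; have lt3 (u : 'Z_3) : u < 3 := ltn_ord u.
  have lt7 (u : 'F_7) : u < 7 := ltn_ord u.
  by rewrite /flag_graph /= adjE // -!layer_step_nat.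
apply: inj_card_bij => [x y /(congr1 val)/= /eqP|]; last by rewrite card_prod !card_ord.
rewrite nth_uniq ?t21 ?code_lt // => /eqP.
case: x y => [j b] [k c] /= eqc.
have b7 : b < 7 := ltn_ord b; have c7 : c < 7 := ltn_ord c.
have jk : j = k by apply: val_inj => /=; lia.
by rewrite jk in eqc *; congr (_, _); apply: val_inj => /=; lia.
Qed.

(** Modulo 7, X^2 + X + 1 = (X - 2) (X - 4); each root has its own table. *)
Lemma kagome7_iso (w : 'F_7) : (w ^+ 2 = -1 - w)%R ->
  graph_iso (layered_graph 3 w [set 1; -1]%R) flag_graph.
Proof.
move=> w2; have w24 : (w == 2%:R)%R || (w == 4%:R)%R.
  have /eqP : ((w - 2%:R) * (w - 4%:R) = 0)%R.
    have seven0 : (7%:R = 0 :> 'F_7)%R by apply: val_inj.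
    transitivity (7%:R * (1 - w))%R; last by rewrite seven0 mul0r.
    by ring: w2.
  by rewrite mulf_eq0 !subr_eq0.
have check (w' : nat) t : all (fun j => all (fun b => all (fun k => all (fun c =>
      flag_adj (nth 0 t (7 * j + b)) (nth 0 t (7 * k + c))
      == kagome_step_nat w' (j, b) (k, c) || kagome_step_nat w' (k, c) (j, b))
      (iota 0 7)) (iota 0 3)) (iota 0 7)) (iota 0 3) ->
  forall j b k c, j < 3 -> b < 7 -> k < 3 -> c < 7 ->
      flag_adj (nth 0 t (7 * j + b)) (nth 0 t (7 * k + c))
      = kagome_step_nat w' (j, b) (k, c) || kagome_step_nat w' (k, c) (j, b).
  move=> h j b k c j3 b7 k3 c7; apply/eqP; move/allP/(_ j): h; rewrite mem_iota => /(_ j3).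
  move/allP/(_ b); rewrite mem_iota => /(_ b7) /allP/(_ k); rewrite mem_iota => /(_ k3).
  by move/allP/(_ c); rewrite mem_iota => /(_ c7).
by case/orP: w24 => /eqP ->; [apply: (@kagome_table_iso 2 kagome_table2)
  | apply: (@kagome_table_iso 4 kagome_table4)] => //; apply: check; vm_compute.
Qed.

(** * Numbered flags and the Fano plane over the field with two elements *)

Local Open Scope ring_scope.

(** Bit triples make statements about vectors decidable by evaluation. *)
Definition bvec (t : bool * bool * bool) : 'rV['F_2]_3 :=
  \row_i (nth false [:: t.1.1; t.1.2; t.2] i)%:R.

Definition bxor (s t : bool * bool * bool) :=
  (s.1.1 (+) t.1.1, s.1.2 (+) t.1.2, s.2 (+) t.2).

Lemma bvec_inj : injective bvec.
Proof.
move=> [[a b] c] [[a' b'] c'] /rowP eqv.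
have bit_inj : injective (fun x : bool => x%:R : 'F_2) by case=> [] [].
have := eqv 0; have := eqv 1; have := eqv (1 + 1); rewrite !mxE /=.
by move=> /bit_inj -> /bit_inj -> /bit_inj ->.
Qed.

Lemma bvec_surj v : exists t, v = bvec t.
Proof.
have bitE (x : 'F_2) : x = (x == 1)%:R.
  by case: x => [[|[|//]]] ?; apply: val_inj.
exists (v 0 0 == 1, v 0 1 == 1, v 0 (1 + 1) == 1); apply/rowP=> i; rewrite mxE /=.
by case: i => [[|[|[|//]]]] i3 /=; rewrite -bitE; congr (v 0 _); apply: val_inj.
Qed.

Lemma bvecD s t : bvec s + bvec t = bvec (bxor s t).
Proof.
have bitD (x y : bool) : x%:R + y%:R = (x (+) y)%:R :> 'F_2 by case: x y => [] []; apply: val_inj.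
by apply/rowP=> i; rewrite !mxE bitD; case: i => [[|[|[|//]]]].
Qed.

Lemma bvec0 : bvec (false, false, false) = 0.
Proof. by apply/rowP=> i; rewrite !mxE; case: i => [[|[|[|//]]]]. Qed.

Lemma mem_bvec3 t a b c :
  (bvec t \in [set bvec a; bvec b; bvec c]) = [|| t == a, t == b | t == c].
Proof. by rewrite !inE !(inj_eq bvec_inj) orbA. Qed.

(* The powers of a root of X ^ 3 = X ^ 2 + 1 in the field with 8 elements; this
   relation makes 0, -1 and -3 the exponents of the points of a line. *)
Definition singer (n : nat) : bool * bool * bool :=
  nth (false, false, false)
    [:: (true, false, false); (false, true, false); (false, false, true); (true, false, true);
        (true, true, true); (true, true, false); (false, true, true)] n.

Definition singer_line (n : nat) (t : bool * bool * bool) :=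
  [|| t == singer n, t == singer ((n + 6) %% 7)%N | t == singer ((n + 4) %% 7)%N].

Definition fano_line_set (n : nat) : {set 'rV['F_2]_3} :=
  [set bvec (singer n); bvec (singer ((n + 6) %% 7)%N); bvec (singer ((n + 4) %% 7)%N)].

Lemma mem_fano_line_set n t : (bvec t \in fano_line_set n) = singer_line n t.
Proof. exact: mem_bvec3. Qed.

Lemma all_iotaP n (Q : pred nat) : all Q (iota 0 n) -> forall k, (k < n)%N -> Q k.
Proof. by move=> h k kn; apply: (all_ordP h (Ordinal kn)). Qed.

Lemma flag_incident (n : 'I_21) :
  [&& fano_point (bvec (singer (flag_point n))), fano_line (fano_line_set (flag_line n))
    & bvec (singer (flag_point n)) \in fano_line_set (flag_line n)].
Proof.
have line7 : (flag_line n < 7)%N by rewrite ltn_mod.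
have points : all (fun k => singer k != (false, false, false)) (iota 0 7) by [].
have pt0 k : (k < 7)%N -> fano_point (bvec (singer k)).
  by move=> k7; rewrite /fano_point -bvec0 (inj_eq bvec_inj) (all_iotaP points k7).
have point7 : (flag_point n < 7)%N by rewrite ltn_divLR.
rewrite pt0 // mem_fano_line_set andTb; apply/andP; split; last first.
  by apply: (@all_ordP 21 (fun k => singer_line (flag_line k) (singer (flag_point k)))).
have := all_iotaP (_ : all (fun k => (singer k != singer ((k + 6) %% 7)%N)
   && (bxor (singer k) (singer ((k + 6) %% 7)%N) == singer ((k + 4) %% 7)%N)) (iota 0 7)) line7.
move=> /(_ isT) /andP[neq /eqP sumE].
apply/existsP; exists (bvec (singer (flag_line n))).
apply/existsP; exists (bvec (singer ((flag_line n + 6) %% 7)%N)).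
by rewrite !pt0 ?ltn_mod // (inj_eq bvec_inj) neq bvecD sumE /=.
Qed.

Definition to_fano_flag (n : 'I_21) : fano_flag :=
  exist _ (bvec (singer (flag_point n)), fano_line_set (flag_line n)) (flag_incident n).

Lemma singer_inj j k : (j < 7)%N -> (k < 7)%N -> singer j = singer k -> j = k.
Proof.
move=> j7 k7 /eqP; rewrite nth_uniq // => /eqP; exact.
Qed.

Lemma fano_line_set_inj j k : (j < 7)%N -> (k < 7)%N -> fano_line_set j = fano_line_set k -> j = k.
Proof.
move=> j7 k7 /setP eqjk.
have check : all (fun j => all (fun k => all (fun n =>
   singer_line j (singer n) == singer_line k (singer n)) (iota 0 7) ==> (j == k)) (iota 0 7)) (iota 0 7) by [].
have /implyP h := all_iotaP (all_iotaP check j7) k7; apply/eqP/h.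
by apply/allP=> n _; rewrite -!mem_fano_line_set eqjk.
Qed.

Lemma flag_pairs_inj (n m : 'I_21) :
  (n == m) = (flag_point n == flag_point m) && (flag_line n == flag_line m).
Proof.
rewrite -(inj_eq val_inj); apply: eqP; move: n m; apply: (@all_ord2P 21 (fun n m =>
  (n == m) == (flag_point n == flag_point m) && (flag_line n == flag_line m))).
by vm_compute.
Qed.

Lemma flag_graph_fano : graph_iso flag_graph fano_flag_graph.
Proof.
have point7 (n : 'I_21) : (flag_point n < 7)%N by rewrite ltn_divLR.
have line7 (n : 'I_21) : (flag_line n < 7)%N by rewrite ltn_mod.
have pE (n m : 'I_21) : ((val (to_fano_flag n)).1 == (val (to_fano_flag m)).1)
    = (flag_point n == flag_point m).
  by apply/eqP/eqP => /= [/bvec_inj/singer_inj -> //|->].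
have lE (n m : 'I_21) : ((val (to_fano_flag n)).2 == (val (to_fano_flag m)).2)
    = (flag_line n == flag_line m).
  by apply/eqP/eqP => /= [/fano_line_set_inj -> //|->].
have flagE (n m : 'I_21) : (to_fano_flag n == to_fano_flag m) = (n == m).
  apply/eqP/eqP => [nm|-> //]; apply/eqP.
  by rewrite flag_pairs_inj -pE -lE nm !eqxx.
have surj (f : fano_flag) : exists n, to_fano_flag n == f.
  case: f => [[v L] inc].
  have /and3P[/= v0 /existsP[a /existsP[b /and4P[a0 b0 neqab /eqP LE]]] vL] := inc.
  have singerP u : fano_point u -> exists2 k, (k < 7)%N & u = bvec (singer k).
    have [t ->] := bvec_surj u; rewrite /fano_point -bvec0 (inj_eq bvec_inj) => t0.
    have : t \in [seq singer k | k <- iota 0 7] by case: t t0 => [[[] []] []].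
    by case/mapP=> k; rewrite mem_iota => /= k7 ->; exists k.
  have [j j7 aE] := singerP a a0; have [k k7 bE] := singerP b b0.
  have jk : j != k by apply: contraNneq neqab => jk; rewrite aE bE jk.
  have [l l7 LlE] : exists2 l, (l < 7)%N & L = fano_line_set l.
    (* Any two distinct points span one of the seven numbered lines; membership is compared on all
       eight vectors, including 0. *)
    have check : all (fun j => all (fun k => (j != k) ==> has (fun l => all (fun t =>
        [|| t == singer j, t == singer k | t == bxor (singer j) (singer k)] == singer_line l t)
        ((false, false, false) :: [seq singer i | i <- iota 0 7])) (iota 0 7)) (iota 0 7)) (iota 0 7).
      by vm_compute.
    have /implyP/(_ jk)/hasP[l] := all_iotaP (all_iotaP check j7) k7.
    rewrite mem_iota => /andP[_ l7] /allP lineE; exists l => //; apply/setP=> u.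
    have [t ->] := bvec_surj u; rewrite LE aE bE bvecD mem_bvec3 mem_fano_line_set.
    by apply/eqP/lineE; case: t => [[[] []] []].
  have [i i7 vE] := singerP v v0.
  have check : all (fun i => all (fun l => singer_line l (singer i) ==>
      has (fun n => (flag_point n == i) && (flag_line n == l)) (iota 0 21)) (iota 0 7)) (iota 0 7).
    by vm_compute.
  have := all_iotaP (all_iotaP check i7) l7.
  rewrite -mem_fano_line_set -LlE -vE vL => /hasP[n]; rewrite mem_iota => /= n21.
  case/andP=> /eqP ni /eqP nl; exists (Ordinal n21); apply/eqP/val_inj => /=.
  by rewrite ni nl -vE -LlE.
exists to_fano_flag; last first.
  move=> n m; rewrite /fano_flag_graph /= flagE pE lE /flag_graph.
  apply/eqP; rewrite eq_sym; move: n m {flagE}.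
  apply: (@all_ord2P 21 (fun n m => flag_adj n m == (n != m) &&
    ((flag_point n == flag_point m) || (flag_line n == flag_line m)))).
  by vm_compute.
(* By [surj] the default [ord0] is never taken. *)
exists (fun f => odflt ord0 [pick n | to_fano_flag n == f]).
  move=> n; case: pickP => [m|/(_ n)]; last by rewrite eqxx.
  by rewrite flagE => /eqP.
move=> f; case: pickP => [m /eqP //|no]; have [n] := surj f.
by rewrite no.
Qed.

(** * The action of PGL(2, 7) by conjugation on traceless matrices *)

Lemma sum_ord2 (R : nmodType) (f : 'I_2 -> R) : \sum_i f i = f 0 + f 1.
Proof.
by rewrite !big_ord_recl big_ord0 addr0; congr (_ + f _); apply: val_inj.
Qed.

Lemma det_mx2 (R : comNzRingType) (A : 'M[R]_2) : \det A = A 0 0 * A 1 1 - A 0 1 * A 1 0.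
Proof.
have lE (i : 'I_2) j : lift i j = if i == 0 then 1 else 0.
  by case: i => [[|[|//]]] ?; case: j => [[|//]] ?; apply: val_inj.
rewrite (expand_det_row _ 0) sum_ord2 /cofactor !det_mx11 !mxE !lE /= expr0 expr1.
ring.
Qed.

Section TracelessMatrices.

Variable F : fieldType.

Definition tmx (a b c : F) : 'M[F]_2 :=
  \matrix_(i, j) if i == 0 then if j == 0 then a else b else if j == 0 then c else - a.

Lemma tmxP (Y : 'M[F]_2) : \tr Y = 0 -> Y = tmx (Y 0 0) (Y 0 1) (Y 1 0).
Proof.
rewrite /mxtrace sum_ord2 => tr0; apply/matrixP=> i j; rewrite mxE.
have o1 (k : 'I_2) : k != 0 -> k = 1 by case: k => [[|[|//]]] // ? _; apply: val_inj.
case: eqP => [->|/eqP/o1 ->]; case: eqP => [->|/eqP/o1 ->] //.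
by apply/eqP; rewrite -addr_eq0 addrC tr0.
Qed.

Lemma tmx_tr a b c : \tr (tmx a b c) = 0.
Proof. by rewrite /mxtrace sum_ord2 !mxE /= subrr. Qed.

Lemma tmx_det a b c : \det (tmx a b c) = - a ^+ 2 - b * c.
Proof. by rewrite det_mx2 !mxE /=; ring. Qed.

Lemma tmxN a b c : - tmx a b c = tmx (- a) (- b) (- c).
Proof. by apply/matrixP=> i j; rewrite !mxE; do 2!case: ifP. Qed.

Lemma tmx_mul_tr a b c a' b' c' :
  \tr (tmx a b c *m tmx a' b' c') = 2%:R * a * a' + b * c' + c * b'.
Proof. by rewrite /mxtrace !sum_ord2 !mxE !sum_ord2 !mxE /=; ring. Qed.

End TracelessMatrices.

(* Representatives modulo sign of the traceless 2 x 2 matrices of determinant 1,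
   numbered so that adjacent flags correspond to orthogonal matrices. *)
Definition involutions : seq (nat * nat * nat) :=
  [:: (0, 1, 6); (2, 3, 3); (3, 5, 5); (1, 2, 6); (1, 3, 4); (2, 1, 2); (2, 5, 6);
      (3, 6, 3); (0, 3, 2); (3, 3, 6); (0, 2, 3); (2, 6, 5); (3, 4, 1); (3, 1, 4);
      (3, 2, 2); (2, 2, 1); (1, 4, 3); (1, 6, 2); (1, 5, 1); (2, 4, 4); (1, 1, 5)]%N.

Definition involution (n : nat) := nth (0, 0, 0)%N involutions n.

Definition involution_mx (n : nat) : 'M['F_7]_2 :=
  tmx (involution n).1.1%:R (involution n).1.2%:R (involution n).2%:R.

Definition up_to_sign (A B : 'M['F_7]_2) := (A == B) || (A == - B).

Lemma up_to_signP A B : reflect (exists b : bool, A = (-1) ^+ b *: B) (up_to_sign A B).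
Proof.
apply: (iffP orP) => [[] /eqP->|[[] ->]].
- by exists false; rewrite expr0 scale1r.
- by exists true; rewrite expr1 scaleN1r.
- by right; rewrite expr1 scaleN1r.
by left; rewrite expr0 scale1r.
Qed.

Lemma up_to_sign_sym A B : up_to_sign A B = up_to_sign B A.
Proof. by rewrite /up_to_sign eq_sym -[A == - B]eqr_opp opprK [- A == _]eq_sym. Qed.

Lemma up_to_sign_trans A B C : up_to_sign A B -> up_to_sign B C -> up_to_sign A C.
Proof.
move=> /up_to_signP[b ->] /up_to_signP[c ->]; apply/up_to_signP.
by exists (b (+) c); rewrite scalerA signr_addb.
Qed.

(** Exhaustion over the entries modulo 7, where determinant 1 means a^2 + b c + 1 = 0. *)
Lemma involution_mx_cover (Y : 'M['F_7]_2) : \tr Y = 0 -> \det Y = 1 ->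
  exists n : 'I_21, up_to_sign Y (involution_mx n).
Proof.
move=> trY; rewrite (tmxP trY) tmx_det; move: (Y 0 0) (Y 0 1) (Y 1 0) => a b c det1.
have check : all (fun a => all (fun b => all (fun c => (a * a + b * c + 1 == 0 %[mod 7]) ==>
    has (fun n => let: (a', b', c') := involution n in
      [&& a == a' %[mod 7], b == b' %[mod 7] & c == c' %[mod 7]] ||
      [&& a + a' == 0 %[mod 7], b + b' == 0 %[mod 7] & c + c' == 0 %[mod 7]])
      (iota 0 21)) (iota 0 7)) (iota 0 7)) (iota 0 7) by vm_compute.
have lt7 (u : 'F_7) : (u < 7)%N := ltn_ord u.
have /implyP := all_iotaP (all_iotaP (all_iotaP check (lt7 a)) (lt7 b)) (lt7 c).
rewrite -Fp_nat_eq // !natrD !natrM !natr_Zp -[X in X + _ + 1]opprK -expr2.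
have -> : - - a ^+ 2 + b * c + 1 == 0 by rewrite -det1; apply/eqP; ring.
move=> /(_ isT) /hasP[n]; rewrite mem_iota => /andP[_ n21].
move=> h; exists (Ordinal n21); move: h; rewrite /up_to_sign /involution_mx /=.
case: (involution n) => [[a' b'] c'] /=; rewrite -!Fp_nat_eq // !natrD !natr_Zp !addr_eq0.
by case/orP=> /and3P[/eqP-> /eqP-> /eqP->]; rewrite ?tmxN eqxx ?orbT.
Qed.

Lemma involution_mx_inj (n m : 'I_21) :
  up_to_sign (involution_mx n) (involution_mx m) -> n = m.
Proof.
have check : all (fun n => all (fun m =>
    (let: (a, b, c) := involution n in let: (a', b', c') := involution m in
      [&& a == a' %[mod 7], b == b' %[mod 7] & c == c' %[mod 7]] ||
      [&& a + a' == 0 %[mod 7], b + b' == 0 %[mod 7] & c + c' == 0 %[mod 7]]) ==> (n == m))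
    (iota 0 21)) (iota 0 21) by vm_compute.
have /implyP h := all_ord2P check n m => nm; apply/val_inj/eqP/h; move: nm.
rewrite /involution_mx; case: (involution n) => [[a b] c]; case: (involution m) => [[a' b'] c'] /=.
have tmx_inj (x y z x' y' z' : 'F_7) : tmx x y z = tmx x' y' z' -> [/\ x = x', y = y' & z = z'].
  move=> /matrixP e; have := e 0 0; have := e 0 1; have := e 1 0.
  by rewrite !mxE /= => -> -> ->.
rewrite -!Fp_nat_eq // !natrD !addr_eq0.
case/orP => /eqP; first by case/tmx_inj=> -> -> ->; rewrite !eqxx.
by rewrite tmxN => /tmx_inj[-> -> ->]; rewrite !eqxx orbT.
Qed.

Lemma involution_mx_det (n : 'I_21) : \det (involution_mx n) = 1.
Proof.
rewrite tmx_det; apply/eqP; rewrite -subr_eq0 -oppr_eq0.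
have -> : - (- (involution n).1.1%:R ^+ 2 - (involution n).1.2%:R * (involution n).2%:R - 1)
   = ((involution n).1.1 ^ 2 + (involution n).1.2 * (involution n).2 + 1)%N%:R :> 'F_7.
  by rewrite !natrD natrX natrM; ring.
rewrite -[0]/(0%:R) Fp_nat_eq //.
by apply: (@all_ordP 21 (fun n => (involution n).1.1 ^ 2 + (involution n).1.2 * (involution n).2 + 1
     == 0 %[mod 7])%N); vm_compute.
Qed.

Lemma flag_graph_trace (n m : 'I_21) :
  flag_graph n m = (n != m) && (\tr (involution_mx n *m involution_mx m) == 0).
Proof.
rewrite tmx_mul_tr -!natrM -!natrD -[0]/(0%:R) Fp_nat_eq //.
rewrite -(inj_eq val_inj); apply: eqP; move: n m; apply: (@all_ord2P 21 (fun n m =>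
  flag_adj n m == (n != m) && (2 * (involution n).1.1 * (involution m).1.1
    + (involution n).1.2 * (involution m).2 + (involution n).2 * (involution m).1.2 == 0 %[mod 7])%N)).
by vm_compute.
Qed.

Notation GL27 := {'GL_2['F_7]}.

Definition conj_mx (g : GL27) (Y : 'M['F_7]_2) : 'M['F_7]_2 := (val g)^-1 * Y * val g.

Lemma val_GL_unit (g : GL27) : (val g : 'M['F_7]_2) \is a GRing.unit.
Proof. exact: valP g. Qed.

Lemma conj_mxM g h Y : conj_mx (g * h)%g Y = conj_mx h (conj_mx g Y).
Proof.
by rewrite /conj_mx FinRing.val_unitM invrM ?val_GL_unit // !mulrA.
Qed.

Lemma conj_mx1 Y : conj_mx 1%g Y = Y.
Proof. by rewrite /conj_mx /= invr1 mul1r mulr1. Qed.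

Lemma conj_mx_mul g Y Z : conj_mx g Y * conj_mx g Z = conj_mx g (Y * Z).
Proof. by rewrite /conj_mx !mulrA mulrK ?val_GL_unit. Qed.

Lemma conj_mx_sign g (b : bool) Y : conj_mx g ((-1) ^+ b *: Y) = (-1) ^+ b *: conj_mx g Y.
Proof. by rewrite /conj_mx -scalerAr -scalerAl. Qed.

Lemma conj_mx_tr g Y : \tr (conj_mx g Y) = \tr Y.
Proof.
by rewrite /conj_mx -[_ * _ * _]/(_ *m _) mxtrace_mulC mulmxE mulrA mulrV ?val_GL_unit ?mul1r.
Qed.

Lemma conj_mx_det g Y : \det (conj_mx g Y) = \det Y.
Proof.
rewrite /conj_mx -!mulmxE !det_mulmx mulrAC -det_mulmx mulmxE mulVr ?val_GL_unit //.
by rewrite det1 mul1r.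
Qed.

(** The default [ord0] is never taken: conjugation preserves trace and determinant, so
    [involution_mx_cover] applies. *)
Definition pgl_act (g : GL27) (n : 'I_21) : 'I_21 :=
  odflt ord0 [pick m : 'I_21 | up_to_sign (conj_mx g (involution_mx n)) (involution_mx m)].

Lemma pgl_actP g (n : 'I_21) : up_to_sign (conj_mx g (involution_mx n)) (involution_mx (pgl_act g n)).
Proof.
rewrite /pgl_act; case: pickP => [m //|no].
have [||m] := @involution_mx_cover (conj_mx g (involution_mx n)).
- by rewrite conj_mx_tr tmx_tr.
- by rewrite conj_mx_det involution_mx_det.
by rewrite no.
Qed.

Lemma pgl_act_uniq g (n m : 'I_21) :
  up_to_sign (conj_mx g (involution_mx n)) (involution_mx m) -> pgl_act g n = m.
Proof.
move=> nm; apply: involution_mx_inj; apply: up_to_sign_trans nm.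
by rewrite up_to_sign_sym pgl_actP.
Qed.

Lemma conj_mx_up_to_sign g A B : up_to_sign A B -> up_to_sign (conj_mx g A) (conj_mx g B).
Proof.
by case/up_to_signP=> b ->; apply/up_to_signP; exists b; rewrite conj_mx_sign.
Qed.

Lemma pgl_actM g h n : pgl_act (g * h)%g n = pgl_act h (pgl_act g n).
Proof.
apply: pgl_act_uniq; rewrite conj_mxM; apply: up_to_sign_trans (pgl_actP h _).
exact/conj_mx_up_to_sign/pgl_actP.
Qed.

Lemma pgl_act1 n : pgl_act 1%g n = n.
Proof. by apply: pgl_act_uniq; rewrite conj_mx1 /up_to_sign eqxx. Qed.

Lemma pgl_act_inj g : injective (pgl_act g).
Proof.
by apply: (can_inj (g := pgl_act g^-1%g)) => n; rewrite -pgl_actM mulgV pgl_act1.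
Qed.

Definition pgl_perm (g : GL27) : {perm 'I_21} := perm (@pgl_act_inj g).

Lemma pgl_permM : {in 'GL_2['F_7]%g &, {morph pgl_perm : g h / (g * h)%g}}.
Proof. by move=> g h _ _; apply/permP=> n; rewrite permM !permE pgl_actM. Qed.

Definition pgl_morphism : {morphism 'GL_2['F_7]%g >-> {perm 'I_21}} := Morphism pgl_permM.

(** Conjugation preserves the trace form, and changes of sign do not affect orthogonality. *)
Lemma pgl_perm_aut g : pgl_perm g \in graph_aut flag_graph.
Proof.
apply/graph_autP=> n m; rewrite !permE !flag_graph_trace (inj_eq (@pgl_act_inj g)).
congr (_ && _); have tr_conj := conj_mx_tr g (involution_mx n * involution_mx m).
rewrite -conj_mx_mul in tr_conj.
have /up_to_signP[b bE] := pgl_actP g n; have /up_to_signP[c cE] := pgl_actP g m.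
rewrite bE cE -scalerAl -scalerAr scalerA mxtraceZ -signr_addb in tr_conj.
by rewrite -[in RHS]mulmxE in tr_conj; rewrite -tr_conj mulf_eq0 signr_eq0.
Qed.

(** [G] commutes up to sign with every representative, and three of them suffice: numbers 0 and 10
    have zero diagonal and force [G] to be diagonal, then number 1 equates its diagonal entries. *)
Lemma pgl_ker_scalar g : pgl_perm g = 1%g -> exists a, val g = a%:M :> 'M['F_7]_2.
Proof.
move=> g1; pose G : 'M['F_7]_2 := val g.
have comm (n : 'I_21) : up_to_sign (involution_mx n * G) (G * involution_mx n).
  have := pgl_actP g n; have -> : pgl_act g n = n.
    by have /permP/(_ n) := g1; rewrite permE perm1.
  case/up_to_signP=> b bE; apply/up_to_signP; exists b.
  by rewrite scalerAr -bE /conj_mx !mulrA mulrV ?val_GL_unit ?mul1r.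
have detG : G 0 0 * G 1 1 - G 0 1 * G 1 0 != 0.
  by rewrite -det_mx2 -unitfE -unitmxE; exact: valP g.
have commE (n : 'I_21) : exists b : bool,
    let x := (involution n).1.1%:R in let y := (involution n).1.2%:R in
    let u := (involution n).2%:R in
    [/\ x * G 0 0 + y * G 1 0 = (-1) ^+ b * (G 0 0 * x + G 0 1 * u),
        x * G 0 1 + y * G 1 1 = (-1) ^+ b * (G 0 0 * y - G 0 1 * x),
        u * G 0 0 - x * G 1 0 = (-1) ^+ b * (G 1 0 * x + G 1 1 * u)
      & u * G 0 1 - x * G 1 1 = (-1) ^+ b * (G 1 0 * y - G 1 1 * x)].
  have /up_to_signP[b bE] := comm n; exists b => x y u; rewrite -!mulmxE in bE.
  have e i j := congr1 (fun A : 'M['F_7]_2 => A i j) bE.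
  have := e 0 0; have := e 0 1; have := e 1 0; have := e 1 1.
  rewrite !mxE !sum_ord2 !mxE /= -/x -/y -/u !mulNr !mulrN.
  by split.
have [b [/= e1 e2 _ _]] := commE (@Ordinal 21 0 isT).
have [c [/= f1 _ _ _]] := commE (@Ordinal 21 10 isT).
have [d [/= h1 h2 _ _]] := commE (@Ordinal 21 1 isT).
rewrite !mul0r !mulr0 !add0r mul1r in e1; rewrite !mul0r !mulr0 !add0r in f1.
rewrite !mul0r !mulr0 !subr0 !add0r mul1r mulr1 in e2.
have G01 : G 0 1 = 0.
  (* Eliminating [G 1 0] leaves [G 0 1] with a coefficient that is nonzero modulo 7 for each choice
     of signs. *)
  have k0 : (-1) ^+ b * 12%:R - (-1) ^+ c * 3%:R != 0 :> 'F_7 by case: (b) (c) => [] [].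
  apply: (mulfI k0); rewrite mulr0 mulrBl.
  by rewrite -[X in _ - X]mulrA [3%:R * _]mulrC -f1 e1; apply/eqP; rewrite subr_eq0; apply/eqP; ring.
have G10 : G 1 0 = 0 by rewrite e1 G01 mul0r mulr0.
rewrite G01 mul0r subr0 in detG; have G00 : G 0 0 != 0 by apply: contraNneq detG => ->; rewrite mul0r.
have d0 : d = false.
  move: h1; rewrite G01 G10 mul0r mulr0 !addr0; case: (d) => //; rewrite expr1 mulN1r => /eqP.
  rewrite -addr_eq0 [G 0 0 * _]mulrC -mulrDl mulf_eq0 (negPf G00) orbF.
  by [].
have G11 : G 1 1 = G 0 0.
  move: h2; rewrite G01 d0 expr0 !mul1r mulr0 mul0r subr0 add0r [G 0 0 * _]mulrC.
  by apply: mulfI.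
exists (G 0 0); apply/matrixP=> i j; rewrite mxE.
have o1 (k : 'I_2) : k != 0 -> k = 1 by case: k => [[|[|//]]] // ? _; apply: val_inj.
by case: (eqVneq i 0) => [->|/o1 ->]; case: (eqVneq j 0) => [->|/o1 ->];
  rewrite -/G ?G01 ?G10 ?G11 ?eqxx ?mulr1n ?mulr0n.
Qed.

Lemma card_pgl_ker : (#|'ker pgl_morphism| <= 6)%N.
Proof.
pose f (g : GL27) : 'F_7 := (val g : 'M['F_7]_2) 0 0.
have scal g : g \in 'ker pgl_morphism -> exists a, val g = a%:M :> 'M['F_7]_2.
  by move=> /mker; apply: pgl_ker_scalar.
rewrite -(card_in_imset (f := f)); last first.
  move=> g h /scal[a ga] /scal[b hb]; rewrite /f ga hb !mxE eqxx !mulr1n => ab.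
  by apply: val_inj; rewrite ga hb ab.
apply: (@leq_trans #|[set~ (0 : 'F_7)]|); last by rewrite cardsC1 card_Fp.
apply/subset_leq_card/subsetP=> _ /imsetP[g /scal[a ga] ->]; rewrite !inE /f ga mxE eqxx mulr1n.
apply/eqP=> a0; have := valP g; rewrite unitmxE ga a0.
by rewrite -scalemx1 scale0r det0 unitr0.
Qed.

Lemma pgl_ker_center : 'ker pgl_morphism = 'Z('GL_2['F_7])%g.
Proof.
apply/setP=> g; apply/idP/idP => [/mker/pgl_ker_scalar[a ga]|/centerP[gG cg]].
  apply/centerP; split=> [|h _]; first by rewrite inE.
  by apply: val_inj; rewrite !FinRing.val_unitM ga -!mulmxE scalar_mxC.
apply/kerP; first by rewrite inE.
apply/permP=> n; rewrite perm1 permE; apply: pgl_act_uniq.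
have Xu : involution_mx n \in unitmx by rewrite unitmxE involution_mx_det unitr1.
pose x : GL27 := FinRing.unit _ (Xu : (involution_mx n : 'M['F_7]_2.-1.+1) \is a GRing.unit).
have /(congr1 val) := cg x (in_setT _); rewrite !FinRing.val_unitM /= => gx.
by rewrite /conj_mx -mulrA -gx mulKr ?val_GL_unit // /up_to_sign eqxx.
Qed.

(** The image of GL(2, 7) has at least 2016 / 6 = 336 elements, which meets the upper bound from the
    frames. *)
Lemma flag_aut_pgl : #|graph_aut flag_graph| = 336%N /\ PGL 2 'F_7 \isog graph_aut flag_graph.
Proof.
have sub : pgl_morphism @* 'GL_2['F_7]%g \subset graph_aut flag_graph.
  apply/subsetP=> _ /morphimP[g _ _ ->]; exact: pgl_perm_aut.
have cardGL : #|'GL_2['F_7]%g| = 2016%N by rewrite card_GL_2 card_Fp.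
have card_im : (336 <= #|pgl_morphism @* 'GL_2['F_7]%g|)%N.
  have := card_pgl_ker; have : (#|'ker pgl_morphism| * #|pgl_morphism @* 'GL_2['F_7]%g| = 2016)%N.
    by rewrite card_morphim setIid Lagrange ?subsetIl.
  nia.
have imE : pgl_morphism @* 'GL_2['F_7]%g = graph_aut flag_graph.
  apply/eqP; rewrite eqEcard sub; exact: leq_trans card_flag_aut_le card_im.
split; first by apply/eqP; rewrite eqn_leq card_flag_aut_le -imE.
by rewrite /PGL -pgl_ker_center -imE; apply: first_isog.
Qed.

(** * The subgroup PGL(3, 2) of index two *)

(** A central element commutes with the transvections [1%:M + delta_mx i j], hence with each
    [delta_mx i j] for [i != j]. *)
Lemma center_GL_scalar (F : finFieldType) n (g : {'GL_n.+2[F]}) :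
  g \in 'Z('GL_n.+2[F])%g -> exists a, val g = a%:M :> 'M[F]_n.+2.
Proof.
case/centerP=> _ cg; pose G : 'M[F]_n.+2 := val g.
have comm (i j : 'I_n.+2) : i != j -> G *m delta_mx i j = delta_mx i j *m G.
  move=> ij; pose T : 'M[F]_n.+2 := 1%:M + delta_mx i j.
  have T_unit : T \in unitmx.
    suff /mulmx1_unit[] : T *m (1%:M - delta_mx i j) = 1%:M by [].
    rewrite mulmxDl mul1mx mulmxBr mulmx1 mul_delta_mx_cond eq_sym (negPf ij) mulr0n subr0.
    by rewrite subrK.
  pose t : {'GL_n.+2[F]} := FinRing.unit _ (T_unit : (T : 'M[F]_n.+2.-1.+1) \is a GRing.unit).
  have /(congr1 val) := cg t (in_setT _); rewrite !FinRing.val_unitM /= -!mulmxE -/G.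
  by rewrite /T mulmxDr mulmxDl mulmx1 mul1mx => /addrI.
have entry i j k : i != j -> G k i = if k == i then G j j else 0.
  move=> ij; have /matrixP/(_ k j) := comm i j ij; rewrite !mxE.
  rewrite (bigD1 i) //= big1 => [|k' /negPf ki]; last by rewrite mxE ki mulr0.
  rewrite (bigD1 j) //= big1 => [|k' /negPf kj]; last by rewrite mxE kj andbF mul0r.
  rewrite !mxE !eqxx mulr1 !addr0 andbT => ->; case: ifP; rewrite ?mul1r ?mul0r //.
have other (i : 'I_n.+2) : exists j, i != j.
  by have [->|i0] := eqVneq i 0; [exists 1 | exists 0].
exists (G 0 0); apply/matrixP=> k i; rewrite -/G mxE.
have [j ij] := other i; rewrite (entry i j k ij); case: eqP => //= _.
have [->|j0] := eqVneq j 0; first by rewrite mulr1n.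
by rewrite mulr1n [RHS](entry 0 j 0) ?eqxx // eq_sym.
Qed.

Section FlagAction.

Notation GL32 := {'GL_3['F_2]}.
Notation V := ('rV['F_2]_3).

Implicit Types (g h : GL32) (f : fano_flag).

Definition mulv (v : V) g : V := v *m (val g : 'M['F_2]_3).

Lemma mulvM v g h : mulv v (g * h)%g = mulv (mulv v g) h.
Proof. by rewrite /mulv FinRing.val_unitM -mulmxE mulmxA. Qed.

Lemma mulv1 v : mulv v 1%g = v.
Proof. exact: mulmx1. Qed.

Lemma mulv_inj g : injective (mulv^~ g).
Proof. by apply: (can_inj (g := mulv^~ g^-1%g)) => v; rewrite -mulvM mulgV mulv1. Qed.

Lemma flag_act_proof g f :
  let x := (mulv (val f).1 g, [set mulv v g | v in (val f).2]) in
  [&& fano_point x.1, fano_line x.2 & x.1 \in x.2].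
Proof.
case: f => [[v L] inc]; have /and3P[/= v0 lineL vL] := inc.
have point u : fano_point u -> fano_point (mulv u g).
  by apply: contraNneq => u0; apply/eqP/(@mulv_inj g); rewrite u0 /mulv mul0mx.
rewrite /= point // andTb; apply/andP; split; last by apply/imsetP; exists v.
case/existsP: lineL => a /existsP[b /and4P[a0 b0 ab /eqP->]].
apply/existsP; exists (mulv a g); apply/existsP; exists (mulv b g).
rewrite !point //= (inj_eq (@mulv_inj g)) ab /=; apply/eqP.
by rewrite !imsetU !imset_set1 /mulv mulmxDl.
Qed.

Definition flag_act g f : fano_flag :=
  exist _ (mulv (val f).1 g, [set mulv v g | v in (val f).2]) (flag_act_proof g f).

Lemma flag_actM g h f : flag_act (g * h)%g f = flag_act h (flag_act g f).
Proof.
apply: val_inj => /=; rewrite mulvM -imset_comp; congr (_, _).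
by apply: eq_imset => v; rewrite /= mulvM.
Qed.

Lemma flag_act1 f : flag_act 1%g f = f.
Proof.
apply: val_inj => /=; rewrite mulv1 (eq_imset _ mulv1) imset_id.
by case: (val f).
Qed.

Lemma flag_act_inj g : injective (flag_act g).
Proof. by apply: (can_inj (g := flag_act g^-1%g)) => f; rewrite -flag_actM mulgV flag_act1. Qed.

Definition flag_perm g : {perm fano_flag} := perm (@flag_act_inj g).

Lemma flag_permM : {in 'GL_3['F_2]%g &, {morph flag_perm : g h / (g * h)%g}}.
Proof. by move=> g h _ _; apply/permP=> f; rewrite permM !permE flag_actM. Qed.

Definition flag_morphism : {morphism 'GL_3['F_2]%g >-> {perm fano_flag}} := Morphism flag_permM.

Lemma flag_perm_aut g : flag_perm g \in graph_aut fano_flag_graph.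
Proof.
apply/graph_autP=> f f'; rewrite !permE /fano_flag_graph /= (inj_eq (@flag_act_inj g)).
by rewrite (inj_eq (@mulv_inj g)) (inj_eq (imset_inj (@mulv_inj g))).
Qed.

(** Over F_2 a point is a single vector. Each basis vector belongs to a flag, so it is fixed, and
    the rows of [g] are those of the identity. *)
Lemma flag_ker_trivial : 'ker flag_morphism = 1%g.
Proof.
apply/trivgP/subsetP=> g /mker g1; rewrite inE; apply/eqP/val_inj/row_matrixP => i.
rewrite !rowE -[RHS]/(mulv _ 1%g) mulv1 -[LHS]/(mulv _ g).
pose v : V := delta_mx 0 i; pose u : V := delta_mx 0 (i + 1).
have v0 : v != 0 by apply/eqP=> /rowP/(_ i)/eqP; rewrite !mxE !eqxx.
have u0 : u != 0 by apply/eqP=> /rowP/(_ (i + 1))/eqP; rewrite !mxE !eqxx.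
have vu : v != u.
  apply/eqP=> /rowP/(_ i)/eqP; rewrite !mxE !eqxx /=.
  by rewrite -[X in X == _ + _]addr0 (inj_eq (addrI _)).
have inc : [&& fano_point (v, [set v; u; v + u]).1, fano_line (v, [set v; u; v + u]).2
    & (v, [set v; u; v + u]).1 \in (v, [set v; u; v + u]).2].
  rewrite /= !inE eqxx andbT /fano_point v0 /=.
  by apply/existsP; exists v; apply/existsP; exists u; rewrite /fano_point v0 u0 vu /=.
pose f : fano_flag := exist _ (v, [set v; u; v + u]) inc.
have /permP/(_ f) := g1; rewrite permE perm1 => /(congr1 val)/(congr1 fst).
exact.
Qed.

Lemma GL32_center : 'Z('GL_3['F_2])%g = 1%g.
Proof.
apply/trivgP/subsetP=> g /center_GL_scalar[a ga]; rewrite inE; apply/eqP/val_inj => /=.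
rewrite ga; have -> : a = 1.
  have : a != 0.
    apply/eqP=> a0; have := valP g; rewrite unitmxE ga a0.
    by rewrite -scalemx1 scale0r det0 unitr0.
  by case: a {ga} => [[|[|//]]] ? _ //; apply: val_inj.
by [].
Qed.

(** The action of GL(3, 2) is faithful, so its image has order 168, and index 2 makes it normal. The
    centre is trivial, so the image is PGL(3, 2). *)
Lemma PGL32_subgroup : #|graph_aut fano_flag_graph| = 336%N ->
  exists N : {group {perm fano_flag}},
    [/\ N <| graph_aut fano_flag_graph, N \isog PGL 3 'F_2
      & #|graph_aut fano_flag_graph : N| = 2%N].
Proof.
move=> card_aut; exists (flag_morphism @* 'GL_3['F_2])%G.
have sub : flag_morphism @* 'GL_3['F_2] \subset graph_aut fano_flag_graph.
  by apply/subsetP=> _ /morphimP[g _ _ ->]; apply: flag_perm_aut.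
have card_im : #|flag_morphism @* 'GL_3['F_2]| = 168%N.
  rewrite card_morphim setIid flag_ker_trivial indexg1 card_GL // card_Fp //.
  by rewrite unlock.
have idx2 : #|graph_aut fano_flag_graph : flag_morphism @* 'GL_3['F_2]| = 2%N.
  by rewrite -divgS // card_im card_aut.
split=> //; first exact: index2_normal.
rewrite isog_sym /PGL GL32_center -flag_ker_trivial; exact: first_isog.
Qed.

End FlagAction.

Local Close Scope ring_scope.

(** * Transport to [Gamma_pq] and determination of the parameters *)

Lemma graph_iso_subgroup (V W : finType) (e : rel V) (f : rel W) (gT : finGroupType)
    (K : {group gT}) :
    graph_iso e f ->
    (exists N : {group {perm W}},
      [/\ N <| graph_aut f, N \isog K & #|graph_aut f : N| = 2]) ->
  exists N : {group {perm V}}, [/\ N <| graph_aut e, N \isog K & #|graph_aut e : N| = 2].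
Proof.
move=> /graph_iso_sym/graph_iso_aut/isogP[c c_inj cE] [N [nN isoN idxN]].
have sN := normal_sub nN; exists (c @* N)%G; split.
- by rewrite -cE morphim_normal.
- have cN := sub_isog sN c_inj; rewrite isog_sym in cN; exact: isog_trans cN isoN.
by rewrite -cE index_injm.
Qed.

Theorem proposition4p3 (p q l i : nat) (m : {unit 'F_p})
  (p_prime : prime p) (q_prime : prime q) (q_dvd : q %| p.-1)
  (m_primitive : <[m]> = [set: {unit 'F_p}])
  (l_gt1 : 1 < l) (l_dvd : l %| p.-1)
  (i_range : (q, i) = (2, 1)%N \/ odd q /\ 1 <= i <= q.-1 %/ 2)
  (prim : vertex_primitive (Gamma_pq m q l i)) :
  [/\ (p, q, l, i) = (7, 3, 2, 1)%N,
      graph_iso (Gamma_pq m q l i) fano_flag_graph,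
      (exists N : {group {perm subg_of (Gpq_group m q)}},
         [/\ N <| graph_aut (Gamma_pq m q l i),
             N \isog PGL 3 'F_2
           & #|graph_aut (Gamma_pq m q l i) : N| = 2])
    & graph_aut (Gamma_pq m q l i) \isog PGL 2 'F_7].
Proof.
have i_gt0 : 0 < i by case: i_range => [[_ ->]|[_ /andP[]]].
have i_ltq : i < q.
  case: i_range => [[-> ->] //|[_ /andP[_ i_le]]].
  apply: leq_ltn_trans i_le _; apply: leq_ltn_trans (leq_div _ _) _.
  by rewrite prednK ?prime_gt0.
have W_q := order_W p_prime q_prime q_dvd m_primitive i_gt0 i_ltq.
have a_l := order_primitive_exp p_prime m_primitive l_dvd.
have iso := Gamma_pq_iso p_prime q_prime q_dvd m_primitive l_gt1 l_dvd i_gt0 i_ltq.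
set W := (m ^+ _ ^+ i) in W_q iso; set a := (m ^+ _) in a_l iso.
have primL := graph_iso_primitive iso prim.
have [q_odd i_le] : odd q /\ i <= q.-1 %/ 2.
  case: i_range => [[q2 _]|[q_odd /andP[_ i_le]]]; last by split.
  have W0 : (val W != 0)%R by apply/eqP => W0; have := valP W; rewrite W0 unitr0.
  have cardU : 1 < #|[set val u | u in <[a]>]|.
    by rewrite card_imset; [rewrite -[#|_|]/(#[a]) a_l | apply: val_inj].
  by move: primL; rewrite q2 (negPf (layered_graph2_imprimitive W0 cardU)).
have q_lt_p : q < p.
  by rewrite -(prednK (prime_gt0 p_prime)) ltnS dvdn_leq // -subn1 subn_gt0 prime_gt1.
have co_pq : coprime p q by rewrite coprime_sym prime_coprime // dvdn_prime2 // neq_ltn q_lt_p.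
have cycU : cyclic [set: {unit 'F_p}] by rewrite -m_primitive cycle_cyclic.
have [q3 a2] : q = 3 /\ #[a] = 2.
  by apply: (primitive_layered_order p_prime q_prime q_odd co_pq cycU W_q _ primL); rewrite a_l.
have UE := unit_cycle2 p_prime a2; rewrite UE in iso primL.
have l2 : l = 2 by rewrite -a_l.
have p_odd : odd p.
  by have [p2|//] := even_prime p_prime; move: q_lt_p; rewrite p2 q3.
(* [W] has order 3, so its value is a root of X^2 + X + 1. *)
have w2 : (val W ^+ 2 = -1 - val W)%R.
  have w1 : (val W - 1 != 0)%R.
    rewrite subr_eq0; apply/eqP=> W1; have /eqP : W = 1 by apply: val_inj.
    by rewrite -order_eq1 W_q q3.
  have w3 : (val W ^+ 3 = 1)%R.
    have /(congr1 val) : W ^+ 3 = 1 by apply/eqP; rewrite -order_dvdn W_q q3.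
    by rewrite !expgS expg0 mulg1 !FinRing.val_unitM => W3; rewrite -[RHS]W3; ring.
  apply: (mulfI w1); transitivity (1 - val W ^+ 2)%R; last by ring.
  by ring: w3.
have i1 : i = 1%N by apply/eqP; rewrite eqn_leq i_gt0 andbT; move: i_le; rewrite q3.
rewrite q3 in primL.
have p7 : p = 7.
  apply: (primitive_kagome p_prime p_odd w2 primL).
  (* [p = 3] is impossible because 3 does not divide 2. *)
  by apply: contraTneq q_dvd => p3; rewrite p3 q3.
have isoF : graph_iso (Gamma_pq m q l i) fano_flag_graph.
  apply: graph_iso_trans iso _; rewrite q3; move: (val W) w2; rewrite p7 => w w2'.
  exact: graph_iso_trans (kagome7_iso w2') flag_graph_fano.
have [card336 pgl_iso] := flag_aut_pgl.
split; first by rewrite p7 q3 l2 i1.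
- exact: isoF.
- apply: graph_iso_subgroup isoF _; apply: PGL32_subgroup.
  by rewrite -(card_isog (graph_iso_aut flag_graph_fano)) card336.
apply: isog_trans (graph_iso_aut isoF) _.
rewrite isog_sym; apply: isog_trans pgl_iso (graph_iso_aut flag_graph_fano).
Qed.
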